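(* Let $X$ be a locally complete ordered set. A morphism $f\colon (A,\alpha)\to(B,\beta)$ of $\mathsf{Ord}//X$ is an effective descent morphism in $\mathsf{Ord}//X$ if and only if the following three conditions hold: (1) $f\colon A\to B$ is an effective descent morphism in $\mathsf{Ord}$; that is, for all $b_0\le b_1\le b_2$ in $B$ there exist $a_0\le a_1\le a_2$ in $A$ with $f(a_0)=b_0$, $f(a_1)=b_1$, $f(a_2)=b_2$. (2) For all $b_0\le b_1$ in $B$ and all $w\in X$ with $w\le\beta(b_0)$, $$w\;\cong\;\bigvee\{\,w\wedge\alpha(a_0)\;:\;a_0,a_1\in A,\ a_0\le a_1,\ f(a_0)=b_0,\ f(a_1)=b_1\,\},$$ the join being taken in $\downarrow\beta(b_0)$. (3) For every family $(\sigma(a))_{a\in A}$ of elements of $X$ with $\sigma(a)\le\alpha(a)$ for all $a\in A$ which satisfies $$\sigma(a')\wedge\alpha(a)\cong\alpha(a')\wedge\sigma(a)\quad\text{for all } b\in B \text{ and all } a,a'\in f^{-1}(b),$$ one has $$\alpha(a')\wedge\bigvee_{a\in f^{-1}(b)}\sigma(a)\;\cong\;\sigma(a')\quad\text{for all } b\in B \text{ and all } a'\in f^{-1}(b),$$ the join being taken in $\downarrow\beta(b)$.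
   Context: An ordered set is a set with a reflexive and transitive relation $\le$ (antisymmetry is not assumed); $x\cong y$ means $x\le y$ and $y\le x$. $\mathsf{Ord}$ is the category of ordered sets and monotone maps. For $x\in X$, $\downarrow x=\{y\in X: y\le x\}$. An ordered set is complete if every subset has a least upper bound (join), equivalently every subset has a greatest lower bound (meet), these being unique up to $\cong$. $X$ is locally complete if $\downarrow x$ is complete for every $x\in X$. Families $\sigma$ are arbitrary functions, not assumed monotone. Binary meets $\wedge$ are meets of pairs of elements having a common upper bound $x$, computed in $\downarrow x$ (the result does not depend on $x$ up to $\cong$). For an ordered set $X$, the lax comma category $\mathsf{Ord}//X$ has as objects pairs $(A,\alpha)$ with $A$ an ordered set and $\alpha\colon A\to X$ a monotone map; a morphism $f\colon(A,\alpha)\to(B,\beta)$ is a monotone map $f\colon A\to B$ with $\alpha(a)\le\beta(f(a))$ for all $a\in A$. When $X$ is locally complete, $\mathsf{Ord}//X$ has pullbacks. In a category $\mathsf{A}$ with pullbacks, a morphism $p\colon E\to B$ is an effective descent morphism (effective for descent) if the pullback functor $p^*\colon\mathsf{A}/B\to\mathsf{A}/E$ is monadic, i.e. the comparison functor $K^p$ from $\mathsf{A}/B$ to the Eilenberg–Moore category of the monad induced by the adjunction $p_!\dashv p^*$ is an equivalence. *)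

(* Defs.v *)
From Stdlib Require Export RelationClasses.
From Stdlib Require Import FunctionalExtensionality ProofIrrelevance
  ClassicalEpsilon.

Set Implicit Arguments.
Unset Strict Implicit.
Unset Printing Implicit Defensive.

Declare Scope cat_scope.
Delimit Scope cat_scope with cat.
Local Open Scope cat_scope.

Record category := Category {
  obj :> Type;
  hom : obj -> obj -> Type;
  idm : forall a, hom a a;
  comp : forall a b c, hom b c -> hom a b -> hom a c;
  comp_idl : forall a b (f : hom a b), comp (idm b) f = f;
  comp_idr : forall a b (f : hom a b), comp f (idm a) = f;
  comp_assoc : forall a b c d (h : hom c d) (g : hom b c) (f : hom a b),
    comp h (comp g f) = comp (comp h g) f
}.

Arguments hom {C} a b : rename.
Arguments idm {C} a : rename.
Arguments comp {C} {a b c} g f : rename.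
Notation "g \o f" := (comp g f) (at level 40, left associativity) : cat_scope.

Record functor (C D : category) := Functor {
  fobj :> C -> D;
  fmap : forall a b, hom a b -> hom (fobj a) (fobj b);
  fmap_id : forall a, fmap (idm a) = idm (fobj a);
  fmap_comp : forall a b c (g : hom b c) (f : hom a b),
    fmap (g \o f) = fmap g \o fmap f
}.

Arguments fmap {C D} f {a b} h : rename.

Definition functor_id (C : category) : functor C C :=
  @Functor C C (fun a => a) (fun _ _ f => f)
    (fun _ => eq_refl) (fun _ _ _ _ _ => eq_refl).

Program Definition functor_comp (C D E : category)
    (G : functor D E) (F : functor C D) : functor C E :=
  {| fobj := fun a => G (F a); fmap := fun a b f => fmap G (fmap F f) |}.
Next Obligation. now rewrite !fmap_id. Qed.
Next Obligation. now rewrite !fmap_comp. Qed.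

Record nat_trans (C D : category) (F G : functor C D) := NatTrans {
  component :> forall a : C, hom (F a) (G a);
  naturality : forall a b (f : hom a b),
    component b \o fmap F f = fmap G f \o component a
}.

Definition is_iso (C : category) (a b : C) (f : hom a b) : Prop :=
  exists g : hom b a, g \o f = idm a /\ f \o g = idm b.

Definition naturally_isomorphic (C D : category) (F G : functor C D) : Prop :=
  exists t : nat_trans F G, forall a, is_iso (t a).

Definition is_equivalence (C D : category) (F : functor C D) : Prop :=
  exists G : functor D C,
    naturally_isomorphic (functor_id C) (functor_comp G F) /\
    naturally_isomorphic (functor_comp F G) (functor_id D).

Record adjunction (C D : category) (F : functor C D) (G : functor D C) :=
  Adjunction {
    adj_unit : nat_trans (functor_id C) (functor_comp G F);
    adj_counit : nat_trans (functor_comp F G) (functor_id D);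
    adj_triangle_l : forall a : C,
      adj_counit (F a) \o fmap F (adj_unit a) = idm (F a);
    adj_triangle_r : forall b : D,
      fmap G (adj_counit b) \o adj_unit (G b) = idm (G b)
  }.

Record monad (C : category) := Monad {
  mfun :> functor C C;
  munit : nat_trans (functor_id C) mfun;
  mmult : nat_trans (functor_comp mfun mfun) mfun;
  mmult_unit_l : forall a, mmult a \o munit (mfun a) = idm (mfun a);
  mmult_unit_r : forall a, mmult a \o fmap mfun (munit a) = idm (mfun a);
  mmult_assoc : forall a,
    mmult a \o fmap mfun (mmult a) = mmult a \o mmult (mfun a)
}.

Program Definition adjunction_monad (C D : category)
    (F : functor C D) (G : functor D C) (adj : adjunction F G) : monad C :=
  {| mfun := functor_comp G F;
     munit := adj_unit adj;
     mmult := {| component := fun a => fmap G (adj_counit adj (F a)) |} |}.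
Next Obligation.
  rewrite <- !fmap_comp. f_equal.
  exact (naturality (adj_counit adj) (fmap F f)).
Qed.
Next Obligation. apply adj_triangle_r. Qed.
Next Obligation.
  rewrite <- fmap_comp, <- fmap_id. f_equal; exact (adj_triangle_l adj a).
Qed.
Next Obligation.
  rewrite <- !fmap_comp. f_equal.
  exact (naturality (adj_counit adj) (adj_counit adj (F a))).
Qed.

Record algebra (C : category) (T : monad C) := Algebra {
  alg_obj : C;
  alg_act : hom (T alg_obj) alg_obj;
  alg_act_unit : alg_act \o munit T alg_obj = idm alg_obj;
  alg_act_mult : alg_act \o fmap T alg_act = alg_act \o mmult T alg_obj
}.

Record algebra_hom (C : category) (T : monad C) (x y : algebra T) :=
  AlgebraHom {
    alg_fun : hom (alg_obj x) (alg_obj y);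
    alg_fun_act : alg_fun \o alg_act x = alg_act y \o fmap T alg_fun
  }.

Lemma algebra_hom_eq (C : category) (T : monad C) (x y : algebra T)
    (f g : algebra_hom x y) : alg_fun f = alg_fun g -> f = g.
Proof.
  destruct f as [f Hf], g as [g Hg]; simpl; intros ->.
  f_equal; apply proof_irrelevance.
Qed.

Program Definition EilenbergMoore (C : category) (T : monad C) : category :=
  {| obj := algebra T;
     hom := @algebra_hom C T;
     idm := fun x => {| alg_fun := idm (alg_obj x) |};
     comp := fun x y z g f => {| alg_fun := alg_fun g \o alg_fun f |} |}.
Next Obligation. now rewrite fmap_id, comp_idl, comp_idr. Qed.
Next Obligation.
  now rewrite <- comp_assoc, alg_fun_act, comp_assoc, alg_fun_act,
    fmap_comp, comp_assoc.
Qed.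
Next Obligation. apply algebra_hom_eq, comp_idl. Qed.
Next Obligation. apply algebra_hom_eq, comp_idr. Qed.
Next Obligation. apply algebra_hom_eq, comp_assoc. Qed.

Program Definition comparison (C D : category)
    (F : functor C D) (G : functor D C) (adj : adjunction F G) :
    functor D (EilenbergMoore (adjunction_monad adj)) :=
  {| fobj := fun b => {| alg_obj := G b; alg_act := fmap G (adj_counit adj b) |};
     fmap := fun b c f => {| alg_fun := fmap G f |} |}.
Next Obligation. apply adj_triangle_r. Qed.
Next Obligation.
  rewrite <- !fmap_comp. f_equal.
  exact (naturality (adj_counit adj) (adj_counit adj b)).
Qed.
Next Obligation.
  rewrite <- !fmap_comp. f_equal.
  symmetry; exact (naturality (adj_counit adj) f).
Qed.
Next Obligation. apply algebra_hom_eq, fmap_id. Qed.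
Next Obligation. apply algebra_hom_eq, fmap_comp. Qed.

Definition monadic (C D : category) (F : functor C D) (G : functor D C)
    (adj : adjunction F G) : Prop :=
  is_equivalence (comparison adj).

Record slice_obj (C : category) (b : C) := SliceObj {
  slice_dom : C;
  slice_map : hom slice_dom b
}.

Record slice_hom (C : category) (b : C) (x y : slice_obj b) := SliceHom {
  slice_fun : hom (slice_dom x) (slice_dom y);
  slice_tri : slice_map y \o slice_fun = slice_map x
}.

Lemma slice_hom_eq (C : category) (b : C) (x y : slice_obj b)
    (f g : slice_hom x y) : slice_fun f = slice_fun g -> f = g.
Proof.
  destruct f as [f Hf], g as [g Hg]; simpl; intros ->.
  f_equal; apply proof_irrelevance.
Qed.

Program Definition slice (C : category) (b : C) : category :=
  {| obj := slice_obj b;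
     hom := @slice_hom C b;
     idm := fun x => {| slice_fun := idm (slice_dom x) |};
     comp := fun x y z g f => {| slice_fun := slice_fun g \o slice_fun f |} |}.
Next Obligation. apply comp_idr. Qed.
Next Obligation. now rewrite comp_assoc, !slice_tri. Qed.
Next Obligation. apply slice_hom_eq, comp_idl. Qed.
Next Obligation. apply slice_hom_eq, comp_idr. Qed.
Next Obligation. apply slice_hom_eq, comp_assoc. Qed.

Record pullback (C : category) (a b c : C) (f : hom a c) (g : hom b c) :=
  Pullback {
    pb_obj : C;
    pb_fst : hom pb_obj a;
    pb_snd : hom pb_obj b;
    pb_square : f \o pb_fst = g \o pb_snd;
    pb_pair : forall (d : C) (u : hom d a) (v : hom d b),
      f \o u = g \o v -> hom d pb_obj;
    pb_fst_pair : forall (d : C) (u : hom d a) (v : hom d b)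
      (e : f \o u = g \o v), pb_fst \o pb_pair e = u;
    pb_snd_pair : forall (d : C) (u : hom d a) (v : hom d b)
      (e : f \o u = g \o v), pb_snd \o pb_pair e = v;
    pb_unique : forall (d : C) (h k : hom d pb_obj),
      pb_fst \o h = pb_fst \o k -> pb_snd \o h = pb_snd \o k -> h = k
  }.

Definition pullbacks (C : category) : Type :=
  forall (a b c : C) (f : hom a c) (g : hom b c), pullback f g.

Section Descent.

Variables (C : category) (pb : pullbacks C) (e b : C) (p : hom e b).

Program Definition slice_push : functor (slice e) (slice b) :=
  {| fobj := fun x : slice e =>
       {| slice_dom := slice_dom x; slice_map := p \o slice_map x |} : slice b;
     fmap := fun x y f => {| slice_fun := slice_fun f |} |}.
Next Obligation. now rewrite <- comp_assoc, slice_tri. Qed.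
Next Obligation. now apply slice_hom_eq. Qed.
Next Obligation. now apply slice_hom_eq. Qed.

Program Definition slice_pull : functor (slice b) (slice e) :=
  {| fobj := fun x : slice b =>
       {| slice_dom := pb_obj (pb p (slice_map x));
          slice_map := pb_fst (pb p (slice_map x)) |} : slice e;
     fmap := fun x y f =>
       {| slice_fun := @pb_pair _ _ _ _ _ _ (pb p (slice_map y)) _
            (pb_fst (pb p (slice_map x)))
            (slice_fun f \o pb_snd (pb p (slice_map x))) _ |} |}.
Next Obligation. now rewrite comp_assoc, slice_tri, pb_square. Qed.
Next Obligation. apply pb_fst_pair. Qed.
Next Obligation.
  apply slice_hom_eq; apply pb_unique; simpl;
    rewrite ?pb_fst_pair, ?pb_snd_pair, ?comp_idl, ?comp_idr; reflexivity.
Qed.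
Next Obligation.
  apply slice_hom_eq; apply pb_unique; simpl;
    rewrite ?comp_assoc, ?pb_fst_pair, ?pb_snd_pair; [reflexivity |].
  now rewrite <- (comp_assoc _ (pb_snd _)), pb_snd_pair, comp_assoc.
Qed.

Program Definition slice_adjunction : adjunction slice_push slice_pull :=
  {| adj_unit := {| component := fun x : slice e =>
       {| slice_fun := @pb_pair _ _ _ _ _ _ (pb p (p \o slice_map x)) _
            (slice_map x) (idm (slice_dom x)) _ |} |};
     adj_counit := {| component := fun x : slice b =>
       {| slice_fun := pb_snd (pb p (slice_map x)) |} |} |}.
Next Obligation. now rewrite comp_idr. Qed.
Next Obligation. apply pb_fst_pair. Qed.
Next Obligation.
  apply slice_hom_eq; apply pb_unique; simpl;
    rewrite ?comp_assoc, ?pb_fst_pair, ?pb_snd_pair.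
  - apply slice_tri.
  - now rewrite <- comp_assoc, pb_snd_pair, comp_idl, comp_idr.
Qed.
Next Obligation. symmetry; apply pb_square. Qed.
Next Obligation. apply slice_hom_eq; simpl. apply pb_snd_pair. Qed.
Next Obligation. apply slice_hom_eq; simpl. apply pb_snd_pair. Qed.
Next Obligation.
  apply slice_hom_eq; apply pb_unique; simpl;
    rewrite ?comp_assoc, ?pb_fst_pair, ?pb_snd_pair, ?comp_idr.
  - reflexivity.
  - now rewrite <- comp_assoc, pb_snd_pair, comp_idr.
Qed.

Definition effective_descent : Prop := monadic slice_adjunction.

End Descent.

Declare Scope ord_scope.
Delimit Scope ord_scope with ord.
Local Open Scope ord_scope.

Record ordset := OrdSet {
  carrier :> Type;
  le : carrier -> carrier -> Prop;
  le_preorder : PreOrder le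
}.

#[global] Existing Instance le_preorder.

Notation "x <= y" := (le x y) : ord_scope.
Notation "x <= y <= z" := (le x y /\ le y z) : ord_scope.

Definition ord_equiv (X : ordset) (x y : X) : Prop := x <= y /\ y <= x.
Notation "x ~= y" := (ord_equiv x y) (at level 70) : ord_scope.

Record monotone (A B : ordset) := Monotone {
  mono_fun :> A -> B;
  mono_le : forall x y, x <= y -> mono_fun x <= mono_fun y
}.

Lemma monotone_eq (A B : ordset) (f g : monotone A B) :
  (forall x, f x = g x) -> f = g.
Proof.
  destruct f as [f Hf], g as [g Hg]; simpl; intros E.
  apply functional_extensionality in E; subst g.
  f_equal; apply proof_irrelevance.
Qed.

Lemma monotone_eqE (A B : ordset) (f g : monotone A B) :
  f = g -> forall x, f x = g x.
Proof. now intros ->. Qed.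

Definition mono_id (A : ordset) : monotone A A :=
  @Monotone A A (fun x => x) (fun _ _ H => H).

Definition mono_comp (A B C : ordset) (g : monotone B C) (f : monotone A B) :
    monotone A C :=
  @Monotone A C (fun x => g (f x)) (fun _ _ H => mono_le g (mono_le f H)).

Program Definition Ord : category :=
  {| obj := ordset; hom := monotone; idm := mono_id; comp := mono_comp |}.
Next Obligation. now apply monotone_eq. Qed.
Next Obligation. now apply monotone_eq. Qed.

Program Definition Ord_pb_obj (A B C : ordset) (f : monotone A C)
    (g : monotone B C) : ordset :=
  {| carrier := {x : A * B | f (fst x) = g (snd x)};
     le := fun x y => fst (proj1_sig x) <= fst (proj1_sig y) /\
                      snd (proj1_sig x) <= snd (proj1_sig y) |}.
Next Obligation.
  split.
  - intros x; split; reflexivity.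
  - intros x y z [H1 H2] [H3 H4]; split; etransitivity; eassumption.
Qed.

Lemma Ord_pb_eq (A B C : ordset) (f : monotone A C) (g : monotone B C)
    (x y : Ord_pb_obj f g) :
  fst (proj1_sig x) = fst (proj1_sig y) ->
  snd (proj1_sig x) = snd (proj1_sig y) -> x = y.
Proof.
  destruct x as [[x1 x2] Hx], y as [[y1 y2] Hy]; simpl; intros -> ->.
  f_equal; apply proof_irrelevance.
Qed.

Definition Ord_pb_fst (A B C : ordset) (f : monotone A C) (g : monotone B C) :
    monotone (Ord_pb_obj f g) A :=
  @Monotone (Ord_pb_obj f g) A (fun x => fst (proj1_sig x))
    (fun _ _ H => proj1 H).

Definition Ord_pb_snd (A B C : ordset) (f : monotone A C) (g : monotone B C) :
    monotone (Ord_pb_obj f g) B :=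
  @Monotone (Ord_pb_obj f g) B (fun x => snd (proj1_sig x))
    (fun _ _ H => proj2 H).

Definition Ord_pb_pair (A B C D : ordset) (f : monotone A C) (g : monotone B C)
    (u : monotone D A) (v : monotone D B) (e : forall d, f (u d) = g (v d)) :
    monotone D (Ord_pb_obj f g) :=
  @Monotone D (Ord_pb_obj f g)
    (fun d => exist (fun x => f (fst x) = g (snd x)) (u d, v d) (e d))
    (fun _ _ H => conj (mono_le u H) (mono_le v H)).

Program Definition Ord_pullbacks : pullbacks Ord :=
  fun A B C f g =>
    {| pb_obj := Ord_pb_obj f g : Ord;
       pb_fst := Ord_pb_fst f g;
       pb_snd := Ord_pb_snd f g;
       pb_pair := fun D u v e => Ord_pb_pair (monotone_eqE e) |}.
Next Obligation. apply monotone_eq; intros [x Hx]; exact Hx. Qed.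
Next Obligation. now apply monotone_eq. Qed.
Next Obligation. now apply monotone_eq. Qed.
Next Obligation.
  apply monotone_eq; intros x; apply Ord_pb_eq;
    [now apply (equal_f H1) | now apply (equal_f H2)].
Qed.

Definition is_lub (X : ordset) (S : X -> Prop) (m : X) : Prop :=
  (forall s, S s -> s <= m) /\
  (forall u, (forall s, S s -> s <= u) -> m <= u).

Definition is_glb (X : ordset) (S : X -> Prop) (m : X) : Prop :=
  (forall s, S s -> m <= s) /\
  (forall l, (forall s, S s -> l <= s) -> l <= m).

Definition complete (X : ordset) : Prop :=
  forall S : X -> Prop, exists m, is_lub S m.

Lemma complete_glb (X : ordset) (HX : complete X) (S : X -> Prop) :
  exists m, is_glb S m.
Proof.
  destruct (HX (fun l => forall s, S s -> l <= s)) as [m [H1 H2]].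
  exists m; split.
  - intros s Hs; apply H2; intros l Hl; now apply Hl.
  - intros l Hl; now apply H1.
Qed.

Program Definition down (X : ordset) (x : X) : ordset :=
  {| carrier := {y : X | y <= x};
     le := fun y z => proj1_sig y <= proj1_sig z |}.
Next Obligation.
  split.
  - intros y; reflexivity.
  - intros y z t H1 H2; etransitivity; eassumption.
Qed.

Definition locally_complete (X : ordset) : Prop :=
  forall x : X, complete (down x).

Section LocallyComplete.

Variables (X : ordset) (HX : locally_complete X).

(* Joins and meets are determined only up to [~=]; a representative is chosen.
   [join_in x S] is the join in [down x] of the elements of [S] lying below
   [x]; it is only meaningful as the join of [S] when [x] bounds [S] above.
   Likewise [meet_in x y z] is the meet of [y] and [z] when [y <= x] and
   [z <= x]. *)
Definition join_in (x : X) (S : X -> Prop) : X :=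
  proj1_sig (proj1_sig (constructive_indefinite_description _
    (HX (x := x) (fun y => S (proj1_sig y))))).

Definition meet_in (x y z : X) : X :=
  proj1_sig (proj1_sig (constructive_indefinite_description _
    (complete_glb (HX (x := x))
       (fun t => proj1_sig t = y \/ proj1_sig t = z)))).

Lemma join_in_le x S : join_in x S <= x.
Proof. unfold join_in; apply proj2_sig. Qed.

Lemma join_in_ub x (S : X -> Prop) y : y <= x -> S y -> y <= join_in x S.
Proof.
  intros Hy HS; unfold join_in.
  destruct constructive_indefinite_description as [m [H1 H2]]; simpl.
  exact (H1 (exist _ y Hy) HS).
Qed.

Lemma join_in_least x (S : X -> Prop) u :
  u <= x -> (forall y, y <= x -> S y -> y <= u) -> join_in x S <= u.
Proof.
  intros Hu H; unfold join_in.
  destruct constructive_indefinite_description as [m [H1 H2]]; simpl.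
  apply (H2 (exist _ u Hu)); intros [y Hy] HS; exact (H y Hy HS).
Qed.

Lemma meet_in_le x y z : meet_in x y z <= x.
Proof. unfold meet_in; apply proj2_sig. Qed.

Lemma meet_in_lel x y z : y <= x -> meet_in x y z <= y.
Proof.
  intros Hy; unfold meet_in.
  destruct constructive_indefinite_description as [m [H1 H2]]; simpl.
  exact (H1 (exist _ y Hy) (or_introl eq_refl)).
Qed.

Lemma meet_in_ler x y z : z <= x -> meet_in x y z <= z.
Proof.
  intros Hz; unfold meet_in.
  destruct constructive_indefinite_description as [m [H1 H2]]; simpl.
  exact (H1 (exist _ z Hz) (or_intror eq_refl)).
Qed.

Lemma meet_in_greatest x y z l :
  l <= x -> l <= y -> l <= z -> l <= meet_in x y z.
Proof.
  intros Hx Hy Hz; unfold meet_in.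
  destruct constructive_indefinite_description as [m [H1 H2]]; simpl.
  apply (H2 (exist _ l Hx)); intros [t Ht] [E | E]; simpl in *; now subst t.
Qed.

End LocallyComplete.

Record lax_obj (X : ordset) := LaxObj {
  lax_dom :> ordset;
  lax_map : monotone lax_dom X
}.

Record lax_hom (X : ordset) (A B : lax_obj X) := LaxHom {
  lax_fun :> monotone A B;
  lax_le : forall a, lax_map A a <= lax_map B (lax_fun a)
}.

Lemma lax_hom_eq (X : ordset) (A B : lax_obj X) (f g : lax_hom A B) :
  lax_fun f = lax_fun g -> f = g.
Proof.
  destruct f as [f Hf], g as [g Hg]; simpl; intros ->.
  f_equal; apply proof_irrelevance.
Qed.

Program Definition LaxComma (X : ordset) : category :=
  {| obj := lax_obj X;
     hom := @lax_hom X;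
     idm := fun A => {| lax_fun := mono_id A |};
     comp := fun A B C g f => {| lax_fun := mono_comp g f |} |}.
Next Obligation. reflexivity. Qed.
Next Obligation. etransitivity; [apply (lax_le f) | apply (lax_le g)]. Qed.
Next Obligation. now apply lax_hom_eq, monotone_eq. Qed.
Next Obligation. now apply lax_hom_eq, monotone_eq. Qed.
Next Obligation. now apply lax_hom_eq, monotone_eq. Qed.

Section LaxPullback.

Variables (X : ordset) (HX : locally_complete X) (A B C : lax_obj X).
Variables (f : lax_hom A C) (g : lax_hom B C).

Definition lax_pb_map (x : Ord_pb_obj f g) : X :=
  meet_in HX (lax_map C (f (fst (proj1_sig x))))
    (lax_map A (fst (proj1_sig x))) (lax_map B (snd (proj1_sig x))).

Lemma lax_pb_map_le1 x : lax_pb_map x <= lax_map A (fst (proj1_sig x)).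
Proof. apply meet_in_lel, lax_le. Qed.

Lemma lax_pb_map_le2 x : lax_pb_map x <= lax_map B (snd (proj1_sig x)).
Proof. apply meet_in_ler; rewrite (proj2_sig x); apply lax_le. Qed.

Lemma lax_pb_map_mono x y : x <= y -> lax_pb_map x <= lax_pb_map y.
Proof.
  intros [H1 H2]; apply meet_in_greatest.
  - etransitivity; [apply meet_in_le | now apply mono_le, mono_le].
  - etransitivity; [apply lax_pb_map_le1 | now apply mono_le].
  - etransitivity; [apply lax_pb_map_le2 | now apply mono_le].
Qed.

Definition Lax_pb_obj : lax_obj X :=
  {| lax_dom := Ord_pb_obj f g;
     lax_map := {| mono_fun := lax_pb_map; mono_le := lax_pb_map_mono |} |}.

Definition Lax_pb_fst : lax_hom Lax_pb_obj A :=
  @LaxHom X Lax_pb_obj A (Ord_pb_fst f g) lax_pb_map_le1.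

Definition Lax_pb_snd : lax_hom Lax_pb_obj B :=
  @LaxHom X Lax_pb_obj B (Ord_pb_snd f g) lax_pb_map_le2.

Program Definition Lax_pb_pair (D : lax_obj X) (u : lax_hom D A)
    (v : lax_hom D B) (e : forall d, f (u d) = g (v d)) :
    lax_hom D Lax_pb_obj :=
  {| lax_fun := Ord_pb_pair e |}.
Next Obligation.
  apply meet_in_greatest; [| apply lax_le | apply lax_le].
  etransitivity; apply lax_le.
Qed.

End LaxPullback.

Lemma lax_hom_eqE (X : ordset) (A B : lax_obj X) (f g : lax_hom A B) :
  f = g -> forall x, f x = g x.
Proof. now intros ->. Qed.

Program Definition LaxComma_pullbacks (X : ordset) (HX : locally_complete X) :
    pullbacks (LaxComma X) :=
  fun A B C f g =>
    {| pb_obj := Lax_pb_obj HX f g : LaxComma X;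
       pb_fst := Lax_pb_fst HX f g;
       pb_snd := Lax_pb_snd HX f g;
       pb_pair := fun D u v e => Lax_pb_pair HX (lax_hom_eqE e) |}.
Next Obligation.
  apply lax_hom_eq, monotone_eq; intros [x Hx]; exact Hx.
Qed.
Next Obligation. now apply lax_hom_eq, monotone_eq. Qed.
Next Obligation. now apply lax_hom_eq, monotone_eq. Qed.
Next Obligation.
  apply lax_hom_eq, monotone_eq; intros x; apply Ord_pb_eq;
    [now apply (equal_f H1) | now apply (equal_f H2)].
Qed.

(* Main.v *)
Require Import Defs.
From Stdlib Require Import ClassicalEpsilon ProofIrrelevance.

(** By the classical criterion, the comparison functor is an equivalence iff it
    is full, faithful and essentially surjective. An algebra over [p : E -> B]
    amounts to an object [D] over [E] with a transport [act e d] of [d] to every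
    [e] in the fibre of its image in [B]. If [p] lifts chains of length three,
    the quotient of [D] by transport is an order over [B] whose pullback is [D].
    In the lax setting the quotient carries the join of the values of [D] along
    each orbit: this is monotone by condition (2), and its pullback gives back
    the values of [D] by condition (3).

    Conversely, fullness applied to identity maps between finite orders over [B]
    lifts pairs and gives (2) for [b0 = b1]. Everything else follows from
    essential surjectivity, applied to algebras with underlying set
    [{(e, i) | p e = y i}] for a family [y : I -> B], where transport keeps [i]:
    with [I] of size three and the relation between the extreme indices omitted,
    such an algebra exists when [p] fails to lift a triple, but cannot descend;
    [I] of size two gives (2), and [I] of size one gives (3). *)

Set Implicit Arguments.
Unset Strict Implicit.
Unset Printing Implicit Defensive.

Local Open Scope cat_scope.
Local Open Scope ord_scope.

(** * Equivalences of categories as full, faithful, essentially surjective functors *)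

Section Equivalences.

Variables (C D : category) (F : functor C D).

Definition faithful : Prop :=
  forall (a b : C) (f g : hom a b), fmap F f = fmap F g -> f = g.

Definition full : Prop :=
  forall (a b : C) (h : hom (F a) (F b)), exists f : hom a b, fmap F f = h.

Definition ess_surj : Prop :=
  forall d : D, exists (c : C) (i : hom (F c) d), is_iso i.

End Equivalences.

Lemma is_iso_monic (C : category) (a b c : C) (i : hom b c) (f g : hom a b) :
  is_iso i -> i \o f = i \o g -> f = g.
Proof.
  intros [j [Hj _]] E.
  now rewrite <- (comp_idl f), <- (comp_idl g), <- Hj, <- !comp_assoc, E.
Qed.

Lemma is_iso_epic (C : category) (a b c : C) (i : hom a b) (f g : hom b c) :
  is_iso i -> f \o i = g \o i -> f = g.
Proof.
  intros [j [_ Hj]] E.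
  now rewrite <- (comp_idr f), <- (comp_idr g), <- Hj, !comp_assoc, E.
Qed.

(** Naturality expresses [t b \o f] through [fmap G (fmap F f)], and the isomorphism [t b]
    cancels. *)
Lemma faithful_of_retract (C D : category) (F : functor C D)
    (G : functor D C) :
  naturally_isomorphic (functor_id C) (functor_comp G F) -> faithful F.
Proof.
  intros [t Ht] a b f g E.
  apply (is_iso_monic (Ht b)).
  pose proof (naturality t f) as Nf; pose proof (naturality t g) as Ng.
  simpl in Nf, Ng; rewrite E in Nf.
  exact (eq_trans Nf (eq_sym Ng)).
Qed.

Lemma naturally_isomorphic_sym (C D : category) (F G : functor C D) :
  naturally_isomorphic F G -> naturally_isomorphic G F.
Proof.
  intros [t Ht].
  set (s := fun a => proj1_sig (constructive_indefinite_description _ (Ht a))).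
  assert (Hs : forall a, s a \o t a = idm _ /\ t a \o s a = idm _).
  { intros a; unfold s; now destruct constructive_indefinite_description. }
  unshelve eexists {| component := s |}.
  - intros a b f; apply (is_iso_monic (Ht b)).
    rewrite !comp_assoc, (proj2 (Hs b)), comp_idl, naturality.
    now rewrite <- comp_assoc, (proj2 (Hs a)), comp_idr.
  - intros a; exists (t a); split; apply Hs.
Qed.

(** For the converse, choice selects preimages of objects with isomorphisms [i], fullness supplies
    the action on morphisms, and faithfulness forces the functor laws. *)
Lemma is_equivalence_iff (C D : category) (F : functor C D) :
  is_equivalence F <-> faithful F /\ full F /\ ess_surj F.
Proof.
  split.
  - intros [G [Heta Heps]].
    assert (FG : faithful G).
    { apply naturally_isomorphic_sym in Heps.
      exact (faithful_of_retract Heps). }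
    split; [exact (faithful_of_retract Heta) | split].
    + destruct Heta as [t Ht]; intros a b h.
      destruct (Ht b) as [s [Hs1 Hs2]].
      (* Naturality of [t] dictates this preimage: any [k] with [fmap F k = h] satisfies
         [t b \o k = fmap G h \o t a]. Since [G] is faithful, the equation may be checked after
         applying [G]. *)
      exists (s \o fmap G h \o t a); apply FG, (is_iso_epic (Ht a)).
      pose proof (naturality t (s \o fmap G h \o t a)) as N; simpl in N.
      etransitivity; [symmetry; exact N |].
      simpl in Hs2 |- *; rewrite !comp_assoc, Hs2.
      exact (f_equal (fun z => z \o t a) (comp_idl (fmap G h))).
    + destruct Heps as [t Ht]; intros d; exists (G d), (t d); exact (Ht d).
  - intros [Hfa [Hfu Hes]].
    set (g := fun d =>
      proj1_sig (constructive_indefinite_description _ (Hes d))).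
    assert (Hi : forall d, exists i : hom (F (g d)) d, is_iso i).
    { intros d; unfold g; now destruct constructive_indefinite_description. }
    set (i := fun d =>
      proj1_sig (constructive_indefinite_description _ (Hi d))).
    assert (Ii : forall d, is_iso (i d)).
    { intros d; unfold i; now destruct constructive_indefinite_description. }
    assert (Hm : forall a b (h : hom a b),
               exists k : hom (g a) (g b), i b \o fmap F k = h \o i a).
    { intros a b h; destruct (Ii b) as [j [_ Hj]].
      destruct (Hfu _ _ (j \o (h \o i a))) as [k Hk]; exists k.
      now rewrite Hk, comp_assoc, Hj, comp_idl. }
    set (m := fun a b (h : hom a b) =>
      proj1_sig (constructive_indefinite_description _ (Hm a b h))).
    assert (Hm' : forall a b (h : hom a b), i b \o fmap F (m a b h) = h \o i a).
    { intros a b h; unfold m.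
      now destruct constructive_indefinite_description. }
    assert (m_id : forall a, m a a (idm a) = idm (g a)).
    { intros a; apply Hfa, (is_iso_monic (Ii a)).
      now rewrite Hm', fmap_id, comp_idl, comp_idr. }
    assert (m_comp : forall a b c (h : hom b c) (k : hom a b),
               m a c (h \o k) = m b c h \o m a b k).
    { intros a b c h k; apply Hfa, (is_iso_monic (Ii c)).
      now rewrite Hm', fmap_comp, comp_assoc, Hm', <- !comp_assoc, Hm'. }
    exists {| fobj := g; fmap := m; fmap_id := m_id; fmap_comp := m_comp |}.
    split.
    (* The components are the preimages under [F] of [i (F a)]; they run from [g (F a)] to [a],
       hence the reversal. *)
    + apply naturally_isomorphic_sym.
      assert (He : forall a : C, exists k : hom (g (F a)) a, fmap F k = i (F a))
        by (intros a; apply Hfu).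
      set (e := fun a =>
        proj1_sig (constructive_indefinite_description _ (He a))).
      assert (He' : forall a, fmap F (e a) = i (F a)).
      { intros a; unfold e; now destruct constructive_indefinite_description. }
      unshelve eexists {| component := e : forall a : C,
        hom (functor_comp {| fobj := g; fmap := m; fmap_id := m_id;
          fmap_comp := m_comp |} F a) (functor_id C a) |}.
      * intros a b f; apply Hfa; simpl; now rewrite !fmap_comp, !He', Hm'.
      * intros a; destruct (Ii (F a)) as [j [Hj1 Hj2]].
        destruct (Hfu _ _ j) as [k Hk]; exists k; simpl.
        split; apply Hfa; now rewrite fmap_comp, fmap_id, He', Hk.
    + unshelve eexists {| component := i : forall d : D,
        hom (functor_comp F {| fobj := g; fmap := m; fmap_id := m_id;
          fmap_comp := m_comp |} d) (functor_id D d) |}.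
      * intros a b h; apply Hm'.
      * exact Ii.
Qed.

(** * Orders: lifting of chains and quotients by transport *)

Section Lifting.

Variables (E B : ordset) (p : monotone E B).

Definition lifts_pairs : Prop :=
  forall b0 b1 : B, b0 <= b1 ->
    exists e0 e1 : E, e0 <= e1 /\ p e0 = b0 /\ p e1 = b1.

Definition lifts_triples : Prop :=
  forall b0 b1 b2 : B, b0 <= b1 <= b2 ->
    exists e0 e1 e2 : E, e0 <= e1 <= e2 /\ p e0 = b0 /\ p e1 = b1 /\ p e2 = b2.

Lemma lifts_triples_pairs : lifts_triples -> lifts_pairs.
Proof.
  intros H b0 b1 Hb.
  destruct (H b0 b1 b1) as (e0 & e1 & _ & [He _] & H0 & H1 & _).
  - split; [exact Hb | reflexivity].
  - now exists e0, e1.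
Qed.

Lemma lifts_pairs_surj : lifts_pairs -> forall b, exists e, p e = b.
Proof.
  intros H b; destruct (H b b) as (e & _ & _ & He & _); [reflexivity |].
  now exists e.
Qed.

Lemma lifts_pairs_section :
  lifts_pairs -> exists s : B -> E, forall b, p (s b) = b.
Proof.
  intros H.
  exists (fun b => proj1_sig
    (constructive_indefinite_description _ (lifts_pairs_surj H b))).
  intros b; now destruct constructive_indefinite_description.
Qed.

Definition pb_pt (Y : ordset) (y : monotone Y B) e d (H : p e = y d) :
    Ord_pb_obj p y :=
  exist _ (e, d) H.

(** The second coordinate of [h] depends only on the point of [Y], so it can be read off over a
    section of [p]. Monotonicity of the resulting map holds because each inequality of [Y] has an
    image in [B] that lifts to [E], where [h] compares the two points. *)
Lemma pb_map_descends (Y Y' : ordset) (y : monotone Y B) (y' : monotone Y' B)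
    (h : monotone (Ord_pb_obj p y) (Ord_pb_obj p y')) :
  lifts_pairs ->
  (forall t, fst (proj1_sig (h t)) = fst (proj1_sig t)) ->
  (forall t u, snd (proj1_sig t) = snd (proj1_sig u) ->
    snd (proj1_sig (h t)) = snd (proj1_sig (h u))) ->
  exists k : monotone Y Y',
    (forall d, y' (k d) = y d) /\
    forall t, snd (proj1_sig (h t)) = k (snd (proj1_sig t)).
Proof.
  intros Hp Hfst Hsnd; destruct (lifts_pairs_section Hp) as [s Hs].
  set (k := fun d => snd (proj1_sig (h (pb_pt (Hs (y d)))))).
  assert (Hk : forall t, snd (proj1_sig (h t)) = k (snd (proj1_sig t)))
    by (intros t; now apply Hsnd).
  unshelve eexists {| mono_fun := k |}.
  - intros d d' Hd.
    destruct (Hp _ _ (mono_le y Hd)) as (e & e' & He & H & H').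
    change (k (snd (proj1_sig (pb_pt H))) <= k (snd (proj1_sig (pb_pt H')))).
    rewrite <- !Hk.
    now apply (mono_le h (x := pb_pt H) (y := pb_pt H')).
  - split; [intros d; simpl | exact Hk].
    unfold k; rewrite <- (proj2_sig (h _)), Hfst; simpl; apply Hs.
Qed.

End Lifting.

(* An algebra of the descent monad of [p], its structure map extended by junk
   to the pairs [(e, d)] that do not lie in the pullback. *)
Record is_action (E B D : ordset) (p : monotone E B) (x : monotone D E)
    (act : E -> D -> D) : Prop := IsAction {
  act_over : forall e d, p e = p (x d) -> x (act e d) = e;
  act_id : forall d, act (x d) d = d;
  act_act : forall e e' d, p e = p (x d) -> p e' = p (x d) ->
    act e (act e' d) = act e d;
  act_mono : forall e e' d d', p e = p (x d) -> p e' = p (x d') ->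
    e <= e' -> d <= d' -> act e d <= act e' d'
}.

Definition act_pt (E B D : ordset) (p : monotone E B) (x : monotone D E) e d
    (H : p e = p (x d)) : Ord_pb_obj p (mono_comp p x) :=
  exist _ (e, d) H.

(** Totality lets the laws of [is_action] be stated without proofs of membership in the pullback as
    arguments; outside the pullback the default is [d]. *)
Definition total_act (E B D : ordset) (p : monotone E B) (x : monotone D E)
    (xi : Ord_pb_obj p (mono_comp p x) -> D) (e : E) (d : D) : D :=
  match excluded_middle_informative (p e = p (x d)) with
  | left H => xi (act_pt H)
  | right _ => d
  end.

Lemma total_actE (E B D : ordset) (p : monotone E B) (x : monotone D E)
    (xi : Ord_pb_obj p (mono_comp p x) -> D) e d (H : p e = p (x d)) :
  total_act xi e d = xi (act_pt H).
Proof.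
  unfold total_act; destruct excluded_middle_informative as [H' | H'].
  - do 2 f_equal; apply proof_irrelevance.
  - contradiction.
Qed.

#[local] Obligation Tactic := idtac.

Lemma total_act_pb (E B D : ordset) (p : monotone E B) (x : monotone D E)
    (xi : Ord_pb_obj p (mono_comp p x) -> D) t :
  xi t = total_act xi (fst (proj1_sig t)) (snd (proj1_sig t)).
Proof.
  destruct t as [[e d] H]; symmetry; exact (total_actE xi H).
Qed.

Section Orbits.

Variables (E B D : ordset) (p : monotone E B) (x : monotone D E).
Variable (act : E -> D -> D).
Hypothesis (Hact : is_action p x act).
Hypothesis (Hp : lifts_triples p).
Variable (s : B -> E).
Hypothesis (Hs : forall b, p (s b) = b).

(* Each orbit of the action has exactly one element over the image of the
   section [s], so these elements serve as the quotient. *)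
Program Definition orbits : ordset :=
  {| carrier := {d : D | x d = s (p (x d))};
     le := fun q r => exists e e', e <= e' /\
       p e = p (x (proj1_sig q)) /\ p e' = p (x (proj1_sig r)) /\
       act e (proj1_sig q) <= act e' (proj1_sig r) |}.
Next Obligation.
  split.
  - intros q; exists (x (proj1_sig q)), (x (proj1_sig q)).
    repeat split; reflexivity.
  - intros q q' q'' (e1 & e1' & L1 & H1 & H1' & A1)
      (e2 & e2' & L2 & H2 & H2' & A2).
    (* The two witnessing pairs need not meet over the middle orbit: [e1'] and [e2] are only in the
       same fibre. A lifted triple gives one chain to which both inequalities are transported. *)
    destruct (Hp (b0 := p (x (proj1_sig q))) (b1 := p (x (proj1_sig q')))
      (b2 := p (x (proj1_sig q'')))) as (a0 & a1 & a2 & [L L'] & P0 & P1 & P2).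
    { rewrite <- H1, <- H1', <- H2' at 1; rewrite <- H1'.
      split; [now apply mono_le |]; rewrite H1', <- H2; now apply mono_le. }
    exists a0, a2; repeat split; try assumption.
    + now transitivity a1.
    + transitivity (act a1 (proj1_sig q')).
      * rewrite <- (act_act Hact (d := proj1_sig q) P0 H1).
        rewrite <- (act_act Hact (d := proj1_sig q') P1 H1').
        apply (act_mono Hact); rewrite ?(act_over Hact); congruence.
      * rewrite <- (act_act Hact (d := proj1_sig q') P1 H2).
        rewrite <- (act_act Hact (d := proj1_sig q'') P2 H2').
        apply (act_mono Hact); rewrite ?(act_over Hact); congruence.
Qed.

(** The order on orbits does not depend on the witnessing pair: transport carries the inequality
    from one pair of comparable points to any other pair over the same base points. *)
Lemma orbits_le_act (q r : orbits) e e' : q <= r -> e <= e' ->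
  p e = p (x (proj1_sig q)) -> p e' = p (x (proj1_sig r)) ->
  act e (proj1_sig q) <= act e' (proj1_sig r).
Proof.
  intros (e1 & e1' & L1 & H1 & H1' & A1) L H H'.
  rewrite <- (act_act Hact H H1), <- (act_act Hact H' H1').
  apply (act_mono Hact); rewrite ?(act_over Hact); congruence.
Qed.

Program Definition orbits_map : monotone orbits B :=
  {| mono_fun := fun q => p (x (proj1_sig q)) |}.
Next Obligation.
  intros q r (e & e' & L & H & H' & _).
  simpl; rewrite <- H, <- H'.
  now apply mono_le.
Qed.

Program Definition orbit_of (d : D) : orbits := act (s (p (x d))) d.
Next Obligation.
  intros d; cbv beta; now rewrite (act_over Hact), Hs by now rewrite Hs.
Qed.

Lemma orbits_map_orbit_of d : p (x d) = orbits_map (orbit_of d).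
Proof. simpl; now rewrite (act_over Hact), Hs by now rewrite Hs. Qed.

Lemma orbits_eq (q r : orbits) : proj1_sig q = proj1_sig r -> q = r.
Proof.
  destruct q as [q Hq], r as [r Hr]; simpl; intros ->.
  f_equal; apply proof_irrelevance.
Qed.

Lemma orbit_of_act e d : p e = p (x d) -> orbit_of (act e d) = orbit_of d.
Proof.
  intros H; apply orbits_eq; simpl.
  rewrite (act_over Hact) by exact H; rewrite H.
  apply (act_act Hact); [apply Hs | exact H].
Qed.

Lemma orbit_of_rep (q : orbits) : orbit_of (proj1_sig q) = q.
Proof.
  apply orbits_eq; simpl; rewrite <- (proj2_sig q); apply (act_id Hact).
Qed.

(** Together with [orbit_unfold], this identifies [D] with the pullback of its quotient. *)
Program Definition orbit_fold : monotone (Ord_pb_obj p orbits_map) D :=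
  {| mono_fun := fun t =>
       act (fst (proj1_sig t)) (proj1_sig (snd (proj1_sig t))) |}.
Next Obligation.
  intros [[e q] H] [[e' q'] H'] [L L']; now apply orbits_le_act.
Qed.

Program Definition orbit_unfold : monotone D (Ord_pb_obj p orbits_map) :=
  {| mono_fun := fun d =>
       @pb_pt _ _ p _ orbits_map (x d) (orbit_of d) (orbits_map_orbit_of d) |}.
Next Obligation.
  intros d d' L; split; [now apply mono_le |].
  exists (x d), (x d'); repeat split; try apply orbits_map_orbit_of.
  - now apply mono_le.
  - simpl; rewrite !(act_act Hact), !(act_id Hact); try easy; now rewrite Hs.
Qed.

Lemma orbit_fold_over t : x (orbit_fold t) = fst (proj1_sig t).
Proof. apply (act_over Hact), (proj2_sig t). Qed.

Lemma orbit_unfoldK d : orbit_fold (orbit_unfold d) = d.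
Proof.
  simpl; rewrite (act_act Hact), (act_id Hact); try easy; now rewrite Hs.
Qed.

Lemma orbit_foldK t : orbit_unfold (orbit_fold t) = t.
Proof.
  apply Ord_pb_eq; simpl.
  - apply (act_over Hact), (proj2_sig t).
  - rewrite orbit_of_act by exact (proj2_sig t); apply orbit_of_rep.
Qed.

End Orbits.

(** * Algebras indexed by a family of points of the base *)

Section Families.

Variables (E B : ordset) (p : monotone E B).
Variables (I : Type) (y : I -> B) (R : I -> I -> Prop).

(* Transitivity of [R] is only required where [p] lifts the chain, which is
   what makes the order on pairs [(e, i)] below transitive. *)
Record lifted_preorder : Prop := LiftedPreorder {
  lifted_refl : forall i, R i i;
  lifted_trans : forall i j k e0 e1 e2,
    p e0 = y i -> p e1 = y j -> p e2 = y k -> e0 <= e1 <= e2 ->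
    R i j -> R j k -> R i k
}.

Hypothesis (HR : lifted_preorder).

Program Definition family : ordset :=
  {| carrier := {t : E * I | p (fst t) = y (snd t)};
     le := fun t u => fst (proj1_sig t) <= fst (proj1_sig u) /\
                      R (snd (proj1_sig t)) (snd (proj1_sig u)) |}.
Next Obligation.
  split.
  - intros t; split; [reflexivity | apply (lifted_refl HR)].
  - intros t u v [L1 R1] [L2 R2]; split.
    { now transitivity (fst (proj1_sig u)). }
    exact (lifted_trans HR (proj2_sig t) (proj2_sig u) (proj2_sig v)
      (conj L1 L2) R1 R2).
Qed.

Lemma family_eq (t u : family) :
  fst (proj1_sig t) = fst (proj1_sig u) ->
  snd (proj1_sig t) = snd (proj1_sig u) -> t = u.
Proof.
  destruct t as [[e i] H], u as [[e' i'] H']; simpl; intros -> ->.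
  f_equal; apply proof_irrelevance.
Qed.

Definition family_pt e i (H : p e = y i) : family := exist _ (e, i) H.

Definition family_fst : monotone family E :=
  @Monotone family E (fun t => fst (proj1_sig t)) (fun _ _ H => proj1 H).

Program Definition family_act :
    monotone (Ord_pb_obj p (mono_comp p family_fst)) family :=
  {| mono_fun := fun t =>
       @family_pt (fst (proj1_sig t))
         (snd (proj1_sig (snd (proj1_sig t)))) _ |}.
Next Obligation.
  intros [[e [[e' i] H']] H]; simpl in *; congruence.
Qed.
Next Obligation.
  intros t u [L [_ HRtu]]; split; [exact L | exact HRtu].
Qed.

(** Only indices whose base points lift to comparable elements are tested, as the pullback along [p]
    sees no other comparison. *)
Definition family_reflected (Q : ordset) (g : I -> Q) : Prop :=
  forall i j e e', p e = y i -> p e' = y j -> e <= e' -> (R i j <-> g i <= g j).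

(** [h'] is monotone with a monotone left inverse, hence preserves and reflects the order. Both
    orders are componentwise with the same first coordinates, so over comparable points [R] must
    agree with the order of [Q]. *)
Lemma family_iso_reflected (Q : ordset) (u : monotone Q B)
    (h : monotone (Ord_pb_obj p u) family)
    (h' : monotone family (Ord_pb_obj p u)) :
  (forall b, exists e, p e = b) ->
  (forall t, h (h' t) = t) ->
  (forall t, fst (proj1_sig (h' t)) = fst (proj1_sig t)) ->
  (forall t v, snd (proj1_sig t) = snd (proj1_sig v) ->
    snd (proj1_sig (h' t)) = snd (proj1_sig (h' v))) ->
  exists g : I -> Q, family_reflected g /\
    forall t, snd (proj1_sig (h' t)) = g (snd (proj1_sig t)).
Proof.
  intros Hp HK Hfst Hsnd.
  set (s := fun b => proj1_sig (constructive_indefinite_description _ (Hp b))).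
  assert (Hs : forall b, p (s b) = b).
  { intros b; unfold s; now destruct constructive_indefinite_description. }
  set (g := fun i => snd (proj1_sig (h' (family_pt (Hs (y i)))))).
  assert (Hg : forall t, snd (proj1_sig (h' t)) = g (snd (proj1_sig t)))
    by (intros t; now apply Hsnd).
  exists g; split; [| exact Hg].
  intros i j e e' H H' L.
  change (R i j <-> g (snd (proj1_sig (family_pt H)))
                    <= g (snd (proj1_sig (family_pt H')))).
  rewrite <- !Hg; split.
  - intros Hij; apply (mono_le h' (x := family_pt H) (y := family_pt H')).
    now split.
  - intros L'.
    enough (L'' : family_pt H <= family_pt H') by exact (proj2 L'').
    rewrite <- (HK (family_pt H)), <- (HK (family_pt H')).
    apply mono_le; split; [| exact L'].
    now rewrite !Hfst.
Qed.

End Families.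

(** * Test objects with three and with two points *)

Variant three := t0 | t1 | t2.

Definition three_rel (i j : three) : Prop :=
  match i, j with
  | t0, t2 | t1, t0 | t2, t0 | t2, t1 => False
  | _, _ => True
  end.

(** If a triple had no lift, [three_rel] would be a [lifted_preorder]. An order [Q] reflecting it is
    transitive, so it relates the extreme indices, and a lift of the outer pair carries this back to
    [three_rel]. *)
Lemma lifts_triples_of_families (E B : ordset) (p : monotone E B) :
  lifts_pairs p ->
  (forall (y : three -> B) (R : three -> three -> Prop),
    lifted_preorder p y R ->
    exists (Q : ordset) (g : three -> Q), family_reflected p y R g) ->
  lifts_triples p.
Proof.
  intros Hp Hfam b0 b1 b2 [L01 L12]; apply NNPP; intros Hno.
  set (y := fun i => match i with t0 => b0 | t1 => b1 | t2 => b2 end).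
  destruct (Hfam y three_rel) as (Q & g & Hg).
  { split.
    - now intros [].
    (* The chain [t0], [t1], [t2] is the only failure of transitivity. *)
    - intros [] [] [] e0 e1 e2 H0 H1 H2 He; simpl; try easy; intros _ _.
      apply Hno; now exists e0, e1, e2. }
  destruct (Hp b0 b1 L01) as (e0 & e1 & Le & H0 & H1).
  destruct (Hp b1 b2 L12) as (e1' & e2 & Le' & H1' & H2).
  destruct (Hp b0 b2) as (e0' & e2' & Le'' & H0' & H2').
  { now transitivity b1. }
  (* The goal [False] is [three_rel t0 t2] by computation. *)
  apply (Hg t0 t2 e0' e2' H0' H2' Le''); transitivity (g t1).
  - now apply (Hg t0 t1 e0 e1 H0 H1 Le).
  - now apply (Hg t1 t2 e1' e2 H1' H2 Le').
Qed.

Definition discrete_bool : ordset := {| carrier := bool; le := eq |}.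

Program Definition chain_bool : ordset :=
  {| carrier := bool; le := fun i j => i = false \/ j = true |}.
Next Obligation.
  split; [intros [] | intros [] [] []]; intuition congruence.
Qed.

Definition bool_pt (B : ordset) (b0 b1 : B) (i : bool) : B :=
  if i then b1 else b0.

Program Definition discrete_bool_map (B : ordset) (b0 b1 : B) :
    monotone discrete_bool B := {| mono_fun := bool_pt b0 b1 |}.
Next Obligation. now intros B b0 b1 i _ []. Qed.

Program Definition chain_bool_map (B : ordset) (b0 b1 : B) (H : b0 <= b1) :
    monotone chain_bool B := {| mono_fun := bool_pt b0 b1 |}.
Next Obligation. now intros B b0 b1 H [] [] []. Qed.

Program Definition bool_id : monotone discrete_bool chain_bool :=
  {| mono_fun := fun i => i |}.
Next Obligation. intros [] _ []; simpl; auto. Qed.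

(** The two pullbacks have the same points; when [b0 <= b1] has no lift, the pullback of the chain
    contains no comparison between different indices, so the identity is monotone. *)
Program Definition pb_chain_discrete (E B : ordset) (p : monotone E B)
    (b0 b1 : B) (H : b0 <= b1)
    (Hno : ~ exists e0 e1, e0 <= e1 /\ p e0 = b0 /\ p e1 = b1) :
    monotone (Ord_pb_obj p (chain_bool_map H))
      (Ord_pb_obj p (discrete_bool_map b0 b1)) :=
  {| mono_fun := fun t => t |}.
Next Obligation.
  intros E B p b0 b1 H Hno [[e i] H1] [[e' j] H2] [L L']; split; [exact L |].
  destruct i, j, L'; simpl in *; try easy; exfalso; apply Hno;
    now exists e, e'.
Qed.

(** * Effective descent of ordered sets *)

Section OrdDescent.

Variables (E B : Ord) (p : hom E B).

Let K := comparison (slice_adjunction Ord_pullbacks p).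

Definition Ord_alg_map (y z : slice B) (h : hom (K y) (K z)) :
    monotone (Ord_pb_obj p (slice_map y)) (Ord_pb_obj p (slice_map z)) :=
  slice_fun (alg_fun h).

(** A morphism of algebras commutes with transport; this is its equation at the point made of the
    first coordinate of [t] and of [u]. *)
Lemma Ord_alg_map_snd (y z : slice B) (h : hom (K y) (K z))
    (t u : Ord_pb_obj p (slice_map y)) :
  snd (proj1_sig t) = snd (proj1_sig u) ->
  snd (proj1_sig (Ord_alg_map h t)) = snd (proj1_sig (Ord_alg_map h u)).
Proof.
  intros Htu.
  pose proof (f_equal (@slice_fun _ _ _ _) (alg_fun_act h)) as Eh.
  assert (H : p (fst (proj1_sig t)) = p (fst (proj1_sig u))).
  { rewrite (proj2_sig t), (proj2_sig u); now f_equal. }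
  pose proof (monotone_eqE Eh
    (exist (fun v => p (fst v) = p (fst (proj1_sig (snd v))))
      (fst (proj1_sig t), u) H)) as Ev.
  apply (f_equal (fun v => snd (proj1_sig v))) in Ev.
  refine (eq_trans _ Ev).
  apply (f_equal (fun v : Ord_pb_obj p (slice_map y) =>
    snd (proj1_sig (Ord_alg_map h v)))).
  apply Ord_pb_eq; [reflexivity | exact Htu].
Qed.

Lemma Ord_alg_map_fst (y z : slice B) (h : hom (K y) (K z))
    (t : Ord_pb_obj p (slice_map y)) :
  fst (proj1_sig (Ord_alg_map h t)) = fst (proj1_sig t).
Proof. exact (monotone_eqE (slice_tri (alg_fun h)) t). Qed.

Lemma Ord_algebra_hom (y z : slice B)
    (h : monotone (Ord_pb_obj p (slice_map y)) (Ord_pb_obj p (slice_map z))) :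
  (forall t, fst (proj1_sig (h t)) = fst (proj1_sig t)) ->
  (forall t u, snd (proj1_sig t) = snd (proj1_sig u) ->
    snd (proj1_sig (h t)) = snd (proj1_sig (h u))) ->
  exists k : hom (K y) (K z), Ord_alg_map k = h.
Proof.
  intros Hfst Hsnd.
  unshelve refine (ex_intro _ (@AlgebraHom _ _ (K y) (K z)
    (@SliceHom Ord E (alg_obj (K y)) (alg_obj (K z)) h _) _) eq_refl).
  - now apply monotone_eq.
  - apply slice_hom_eq, monotone_eq; intros t; apply Ord_pb_eq; simpl.
    + now rewrite Hfst.
    + now apply Hsnd.
Qed.

Definition Ord_alg_map_of (a : EilenbergMoore (adjunction_monad
      (slice_adjunction Ord_pullbacks p))) :
    monotone (slice_dom (alg_obj a)) E :=
  slice_map (alg_obj a).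

Definition Ord_alg_act (a : EilenbergMoore (adjunction_monad
      (slice_adjunction Ord_pullbacks p))) :
    monotone (Ord_pb_obj p (mono_comp p (Ord_alg_map_of a)))
      (slice_dom (alg_obj a)) :=
  slice_fun (alg_act a).

(** The four clauses come, in order, from the triangle over [E], the unit law, the multiplication
    law at a nested point, and monotonicity of the structure map. *)
Lemma Ord_alg_act_is_action a :
  is_action p (Ord_alg_map_of a) (total_act (Ord_alg_act a)).
Proof.
  assert (Hover : forall e d, p e = p (Ord_alg_map_of a d) ->
      Ord_alg_map_of a (total_act (Ord_alg_act a) e d) = e).
  { intros e d H; rewrite (total_actE _ H).
    exact (monotone_eqE (slice_tri (alg_act a)) (act_pt H)). }
  split; [exact Hover | | |].
  - intros d; rewrite (total_actE _ eq_refl).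
    pose proof (monotone_eqE (f_equal (@slice_fun _ _ _ _) (alg_act_unit a)) d)
      as Hd.
    refine (eq_trans _ Hd).
    apply (f_equal (Ord_alg_act a)), Ord_pb_eq; reflexivity.
  - intros e e' d H H'.
    assert (H'' : p e = p (Ord_alg_map_of a (total_act (Ord_alg_act a) e' d)))
      by (rewrite Hover; congruence).
    rewrite (total_actE _ H''), (total_actE _ H).
    assert (H1 : p e = p (fst (proj1_sig (act_pt H')))) by (simpl; congruence).
    pose proof (monotone_eqE (f_equal (@slice_fun _ _ _ _) (alg_act_mult a))
      (exist (fun v => p (fst v) = p (fst (proj1_sig (snd v))))
        (e, act_pt H') H1)) as Hd.
    refine (eq_trans _ (eq_trans Hd _)); 
      apply (f_equal (Ord_alg_act a)), Ord_pb_eq; try reflexivity.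
    apply total_actE.
  - intros e e' d d' H H' Le Ld; rewrite (total_actE _ H), (total_actE _ H').
    apply mono_le; now split.
Qed.

Lemma Ord_effective_descent_of_lifts :
  lifts_triples p -> effective_descent Ord_pullbacks p.
Proof.
  intros Hp; pose proof (lifts_triples_pairs Hp) as Hp2.
  destruct (lifts_pairs_section Hp2) as [s Hs].
  apply is_equivalence_iff; split; [| split].
  (* Faithfulness: every [d] is the second coordinate of a pullback point, namely the one over the
     section. *)
  - intros y z f g Efg; apply slice_hom_eq, monotone_eq; intros d.
    pose proof (monotone_eqE (f_equal (@Ord_alg_map y z) Efg)
      (@pb_pt _ _ p _ (slice_map y) _ d (Hs _))) as Ed.
    exact (f_equal (fun v => snd (proj1_sig v)) Ed).
  - intros y z h.
    destruct (pb_map_descends Hp2 (Ord_alg_map_fst h)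
      (@Ord_alg_map_snd y z h)) as (k & Hk1 & Hk2).
    unshelve eexists {| slice_fun := k : hom (slice_dom y) (slice_dom z) |}.
    + now apply monotone_eq.
    + apply algebra_hom_eq, slice_hom_eq, monotone_eq; intros t.
      apply Ord_pb_eq; symmetry; [exact (Ord_alg_map_fst h t) | exact (Hk2 t)].
  (* Essential surjectivity: the algebra descends to its order of orbits, with [orbit_fold] and
     [orbit_unfold] as mutually inverse morphisms. *)
  - intros a; pose proof (Ord_alg_act_is_action a) as Hact.
    set (c := @SliceObj Ord B (orbits Hact Hp s) (orbits_map Hact Hp s)).
    unshelve refine (ex_intro _ c (ex_intro _ (@AlgebraHom _ _ (K c) a
      (@SliceHom Ord E (alg_obj (K c)) (alg_obj a)
        (orbit_fold Hact Hp s) _) _) _)).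
    + apply monotone_eq; intros t; exact (orbit_fold_over t).
    + apply slice_hom_eq, monotone_eq; intros t.
      refine (eq_trans _ (eq_sym (total_act_pb (Ord_alg_act a) _))).
      destruct t as [[e [[e' q] H']] H]; symmetry; apply (act_act Hact).
      * exact (eq_trans H H').
      * exact H'.
    + unshelve refine (ex_intro _ (@AlgebraHom _ _ a (K c)
        (@SliceHom Ord E (alg_obj a) (alg_obj (K c))
          (orbit_unfold Hact Hp Hs) _) _) _).
      * now apply monotone_eq.
      * apply slice_hom_eq, monotone_eq; intros t.
        apply Ord_pb_eq; [exact (monotone_eqE (slice_tri (alg_act a)) t) |].
        refine (eq_trans (f_equal (orbit_of Hact Hp Hs)
          (total_act_pb (Ord_alg_act a) t)) _).
        apply orbit_of_act; exact (proj2_sig t).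
      * split; apply algebra_hom_eq, slice_hom_eq, monotone_eq; intros t.
        -- exact (orbit_foldK Hs t).
        -- exact (orbit_unfoldK Hact Hp Hs t).
Qed.

(** Were [b0 <= b1] without a lift, the chain and the discrete pair over [b0], [b1] would have the
    same pullback. Fullness would then give a monotone map from the chain to the discrete pair that
    fixes both points, which is absurd. *)
Lemma Ord_effective_descent_lifts_pairs :
  effective_descent Ord_pullbacks p -> lifts_pairs p.
Proof.
  intros Hed; apply is_equivalence_iff in Hed; destruct Hed as (Hfa & Hfu & _).
  intros b0 b1 Hb; apply NNPP; intros Hno.
  set (y := @SliceObj Ord B discrete_bool (discrete_bool_map b0 b1) : slice B).
  set (z := @SliceObj Ord B chain_bool (chain_bool_map Hb) : slice B).
  unshelve epose (i := @SliceHom Ord B y z bool_id _ : hom y z).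
  { now apply monotone_eq. }
  destruct (@Ord_algebra_hom z y (pb_chain_discrete Hb Hno)) as [h Hh];
    [easy | easy |].
  destruct (Hfu z y h) as [k Hk].
  (* The pullback of [i \o k] is the identity, and [i] is the identity on points, so faithfulness
     shows that [k] fixes the points. *)
  assert (Eik : i \o k = idm z).
  { apply Hfa; rewrite fmap_comp, fmap_id; unfold K in h, Hk; rewrite Hk.
    apply algebra_hom_eq, slice_hom_eq, monotone_eq; intros t.
    pose proof (monotone_eqE Hh t) as Et.
    apply Ord_pb_eq.
    - exact (f_equal (fun v => fst (proj1_sig v)) Et).
    - exact (f_equal (fun v => snd (proj1_sig v)) Et). }
  assert (Ek : forall j, slice_fun k j = j)
    by exact (monotone_eqE (f_equal (@slice_fun _ _ _ _) Eik)).
  pose proof (mono_le (slice_fun k) (x := false) (y := true)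
    (or_introl eq_refl)) as Hft.
  rewrite !Ek in Hft; discriminate Hft.
Qed.

(** Essential surjectivity presents the algebra on [family] as the pullback of an object over [B],
    whose domain serves as [Q]. *)
Lemma Ord_effective_descent_family :
  effective_descent Ord_pullbacks p ->
  forall (I : Type) (y : I -> B) (R : I -> I -> Prop),
  lifted_preorder p y R ->
  exists (Q : ordset) (g : I -> Q), family_reflected p y R g.
Proof.
  intros Hed I y R HR.
  pose proof (lifts_pairs_surj (Ord_effective_descent_lifts_pairs Hed)) as Hp.
  apply is_equivalence_iff in Hed; destruct Hed as (_ & _ & Hes).
  set (T := adjunction_monad (slice_adjunction Ord_pullbacks p)).
  set (D := @SliceObj Ord E (family HR) (family_fst HR) : slice E).
  unshelve epose (xi := @SliceHom Ord E (T D) D (family_act HR) _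
    : hom (T D) D).
  { now apply monotone_eq. }
  unshelve epose (a := @Algebra _ T D xi _ _).
  { apply slice_hom_eq, monotone_eq; intros t.
    apply family_eq; simpl; reflexivity. }
  { apply slice_hom_eq, monotone_eq; intros t.
    apply family_eq; simpl; reflexivity. }
  destruct (Hes a) as (c & h & h' & _ & Hh).
  destruct (@family_iso_reflected E B p I y R HR (slice_dom c) (slice_map c)
    (slice_fun (alg_fun h)) (slice_fun (alg_fun h'))) as (g & Hg & _).
  - exact Hp.
  - exact (monotone_eqE (f_equal (fun k : algebra_hom a a =>
      slice_fun (alg_fun k)) Hh)).
  - exact (monotone_eqE (slice_tri (alg_fun h'))).
  (* [h'] commutes with transport, and transporting [v] to the first coordinate of [t] yields [t],
     while in the pullback transport leaves the second coordinate unchanged. *)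
  - intros t v Htv.
    assert (H : p (fst (proj1_sig t)) = p (fst (proj1_sig v)))
      by now rewrite (proj2_sig t), (proj2_sig v), Htv.
    pose proof (monotone_eqE (f_equal (@slice_fun _ _ _ _) (alg_fun_act h'))
      (act_pt (x := family_fst HR) H)) as Ev.
    refine (eq_trans _ (f_equal (fun v => snd (proj1_sig v)) Ev)).
    apply (f_equal (fun v : family HR =>
      snd (proj1_sig (slice_fun (alg_fun h') v)))).
    now apply family_eq.
  - now exists (slice_dom c), g.
Qed.

Theorem Ord_effective_descent_iff :
  effective_descent Ord_pullbacks p <-> lifts_triples p.
Proof.
  split; [| apply Ord_effective_descent_of_lifts].
  intros Hed; apply lifts_triples_of_families.
  - now apply Ord_effective_descent_lifts_pairs.
  - now apply Ord_effective_descent_family.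
Qed.

End OrdDescent.

(** * Effective descent in the lax comma category *)

Section LocalJoins.

Variables (X : ordset) (HX : locally_complete X).

(** A bound [u] need not lie below [x]. It is replaced by its meet with [x], which exists below the
    common bound [y] and bounds the same elements. *)
Lemma join_in_le_above (x y u : X) (S : X -> Prop) :
  x <= y -> u <= y -> (forall z, z <= x -> S z -> z <= u) ->
  join_in HX x S <= u.
Proof.
  intros Hxy Huy H; transitivity (meet_in HX y x u).
  - apply join_in_least; [now apply meet_in_lel |].
    intros z Hz HS; apply meet_in_greatest; [now transitivity x | easy |].
    now apply H.
  - now apply meet_in_ler.
Qed.

Lemma meet_in_le_meet_in (x x' y z y' z' : X) :
  y <= x -> z <= x -> x <= x' -> y <= y' -> z <= z' ->
  meet_in HX x y z <= meet_in HX x' y' z'.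
Proof.
  intros Hy Hz Hx Hy' Hz'; apply meet_in_greatest.
  - transitivity x; [apply meet_in_le | exact Hx].
  - transitivity y; [now apply meet_in_lel | exact Hy'].
  - transitivity z; [now apply meet_in_ler | exact Hz'].
Qed.

Lemma meet_in_swap_le (x y z : X) :
  y <= x -> z <= x -> meet_in HX x y z <= meet_in HX x z y.
Proof.
  intros Hy Hz; apply meet_in_greatest;
    [apply meet_in_le | now apply meet_in_ler | now apply meet_in_lel].
Qed.

End LocalJoins.

Definition const_mono (A B : ordset) (b : B) : monotone A B :=
  @Monotone A B (fun _ => b) (fun _ _ _ => reflexivity b).

Definition unit_ord : ordset := {| carrier := unit; le := eq |}.

Lemma Lax_slice_ext (X : ordset) (C : LaxComma X) (y z : slice C)
    (g h : hom y z) :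
  (forall t, slice_fun g t = slice_fun h t) -> g = h.
Proof. intros E; now apply slice_hom_eq, lax_hom_eq, monotone_eq. Qed.

Section LaxDescent.

Variables (X : ordset) (HX : locally_complete X).
Variables (A B : LaxComma X) (f : hom A B).

Let alpha : monotone (lax_dom A) X := lax_map A.
Let beta : monotone (lax_dom B) X := lax_map B.
Let F : monotone (lax_dom A) (lax_dom B) := lax_fun f.
Let adj := slice_adjunction (LaxComma_pullbacks HX) f.
Let T := adjunction_monad adj.
Let K := comparison adj.

(** Condition (2) reduced to one inequality; the join lies below [w] in any case. *)
Definition lifted_joins : Prop :=
  forall b0 b1 : lax_dom B, b0 <= b1 ->
  forall w : X, w <= beta b0 ->
    w <= join_in HX (beta b0) (fun x => exists a0 a1 : lax_dom A,
           a0 <= a1 /\ F a0 = b0 /\ F a1 = b1 /\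
           x = meet_in HX (beta b0) w (alpha a0)).

Definition compatible (b : lax_dom B) (sigma : lax_dom A -> X) : Prop :=
  forall a a', F a = b -> F a' = b ->
    meet_in HX (beta b) (alpha a') (sigma a) <= sigma a'.

(** Condition (3) on a single fibre, with the inequality that can fail; values of [sigma] off the
    fibre are unconstrained. *)
Definition fibre_joins : Prop :=
  forall (b : lax_dom B) (sigma : lax_dom A -> X),
    (forall a, F a = b -> sigma a <= alpha a) -> compatible b sigma ->
    forall a', F a' = b ->
      meet_in HX (beta b) (alpha a')
        (join_in HX (beta b) (fun x => exists a, F a = b /\ x = sigma a))
      <= sigma a'.

Lemma alpha_le a b : F a = b -> alpha a <= beta b.
Proof. intros <-; apply (lax_le f). Qed.

Definition Lax_alg_map (y z : slice B) (h : hom (K y) (K z)) :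
    lax_hom (Lax_pb_obj HX f (slice_map y)) (Lax_pb_obj HX f (slice_map z)) :=
  slice_fun (alg_fun h).

Lemma Lax_alg_map_snd (y z : slice B) (h : hom (K y) (K z))
    (t u : Ord_pb_obj F (slice_map y)) :
  snd (proj1_sig t) = snd (proj1_sig u) ->
  snd (proj1_sig (Lax_alg_map h t)) = snd (proj1_sig (Lax_alg_map h u)).
Proof.
  intros Htu.
  pose proof (f_equal (@slice_fun _ _ _ _) (alg_fun_act h)) as Eh.
  assert (H : F (fst (proj1_sig t)) = F (fst (proj1_sig u))).
  { rewrite (proj2_sig t), (proj2_sig u); now f_equal. }
  pose proof (lax_hom_eqE Eh
    (exist (fun v => F (fst v) = F (fst (proj1_sig (snd v))))
      (fst (proj1_sig t), u) H)) as Ev.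
  apply (f_equal (fun v => snd (proj1_sig v))) in Ev.
  refine (eq_trans _ Ev).
  apply (f_equal (fun v : Ord_pb_obj F (slice_map y) =>
    snd (proj1_sig (Lax_alg_map h v)))).
  apply Ord_pb_eq; [reflexivity | exact Htu].
Qed.

Lemma Lax_alg_map_fst (y z : slice B) (h : hom (K y) (K z))
    (t : Ord_pb_obj F (slice_map y)) :
  fst (proj1_sig (Lax_alg_map h t)) = fst (proj1_sig t).
Proof. exact (lax_hom_eqE (slice_tri (alg_fun h)) t). Qed.

Lemma Lax_algebra_hom (y z : slice B)
    (h : lax_hom (Lax_pb_obj HX f (slice_map y))
                 (Lax_pb_obj HX f (slice_map z))) :
  (forall t, fst (proj1_sig (h t)) = fst (proj1_sig t)) ->
  (forall t u, snd (proj1_sig t) = snd (proj1_sig u) ->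
    snd (proj1_sig (h t)) = snd (proj1_sig (h u))) ->
  exists k : hom (K y) (K z), Lax_alg_map k = h.
Proof.
  intros Hfst Hsnd.
  unshelve refine (ex_intro _ (@AlgebraHom _ _ (K y) (K z)
    (@SliceHom (LaxComma X) A (alg_obj (K y)) (alg_obj (K z)) h _) _) eq_refl).
  - now apply lax_hom_eq, monotone_eq.
  - apply slice_hom_eq, lax_hom_eq, monotone_eq; intros t.
    apply Ord_pb_eq; simpl.
    + now rewrite Hfst.
    + now apply Hsnd.
Qed.

Lemma Lax_alg_map_eq (y z : slice B) (h k : hom (K y) (K z)) :
  (forall t, Lax_alg_map h t = Lax_alg_map k t) -> h = k.
Proof.
  intros E; now apply algebra_hom_eq, slice_hom_eq, lax_hom_eq, monotone_eq.
Qed.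

Definition Lax_alg_over (a : EilenbergMoore T) :
    lax_hom (slice_dom (alg_obj a)) A :=
  slice_map (alg_obj a).

Definition Lax_alg_act (a : EilenbergMoore T) :
    monotone (Ord_pb_obj F (mono_comp F (Lax_alg_over a)))
      (lax_dom (slice_dom (alg_obj a))) :=
  lax_fun (slice_fun (alg_act a)).

Lemma Lax_alg_act_is_action a :
  is_action F (Lax_alg_over a) (total_act (Lax_alg_act a)).
Proof.
  assert (Hover : forall e d, F e = F (Lax_alg_over a d) ->
      Lax_alg_over a (total_act (Lax_alg_act a) e d) = e).
  { intros e d H; rewrite (total_actE _ H).
    exact (lax_hom_eqE (slice_tri (alg_act a)) (act_pt H)). }
  split; [exact Hover | | |].
  - intros d; rewrite (total_actE _ eq_refl).
    pose proof (lax_hom_eqE (f_equal (@slice_fun _ _ _ _) (alg_act_unit a)) d)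
      as Hd.
    refine (eq_trans _ Hd).
    apply (f_equal (Lax_alg_act a)), Ord_pb_eq; reflexivity.
  - intros e e' d H H'.
    assert (H'' : F e = F (Lax_alg_over a (total_act (Lax_alg_act a) e' d)))
      by (rewrite Hover; congruence).
    rewrite (total_actE _ H''), (total_actE _ H).
    assert (H1 : F e = F (fst (proj1_sig (act_pt H')))) by (simpl; congruence).
    pose proof (lax_hom_eqE (f_equal (@slice_fun _ _ _ _) (alg_act_mult a))
      (exist (fun v => F (fst v) = F (fst (proj1_sig (snd v))))
        (e, act_pt H') H1)) as Hd.
    refine (eq_trans _ (eq_trans Hd _));
      apply (f_equal (Lax_alg_act a)), Ord_pb_eq; try reflexivity.
    apply total_actE.
  - intros e e' d d' H H' Le Ld; rewrite (total_actE _ H), (total_actE _ H').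
    apply mono_le; now split.
Qed.

(** The value of a pullback point is a meet, so this is laxness of the structure map. *)
Lemma Lax_alg_act_le a e d : F e = F (Lax_alg_over a d) ->
  meet_in HX (beta (F e)) (alpha e) (lax_map _ d) <=
  lax_map _ (total_act (Lax_alg_act a) e d).
Proof.
  intros H; rewrite (total_actE _ H).
  exact (lax_le (slice_fun (alg_act a)) (act_pt H)).
Qed.

(** * The three conditions imply effective descent *)

Section Sufficiency.

Hypothesis (HF : lifts_triples F) (HJ : lifted_joins) (HS : fibre_joins).

(** Condition (2) with [b0 = b1 = b] makes [w] a join of meets with values of [alpha] on the fibre,
    so inequalities below [beta b] may be tested there. *)
Lemma fibre_joins_le b w u : w <= beta b -> u <= beta b ->
  (forall a, F a = b -> meet_in HX (beta b) w (alpha a) <= u) -> w <= u.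
Proof.
  intros Hw Hu H.
  transitivity (join_in HX (beta b) (fun x => exists a0 a1 : lax_dom A,
    a0 <= a1 /\ F a0 = b /\ F a1 = b /\ x = meet_in HX (beta b) w (alpha a0))).
  - apply HJ; [reflexivity | exact Hw].
  - apply join_in_least; [exact Hu |].
    intros z _ (a0 & a1 & _ & H0 & _ & ->); now apply H.
Qed.

Section Quotient.

Variables (D : lax_obj X) (x : lax_hom D A) (act : lax_dom A -> D -> D).
Hypothesis (Hact : is_action F x act).
Hypothesis (Hlax : forall e d, F e = F (x d) ->
  meet_in HX (beta (F e)) (alpha e) (lax_map D d) <= lax_map D (act e d)).
Variables (s : lax_dom B -> lax_dom A) (Hs : forall b, F (s b) = b).

(** The least value, up to equivalence, for which [orbit_unfold] is lax. *)
Definition orbit_join (q : orbits Hact HF s) : X :=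
  join_in HX (beta (F (x (proj1_sig q)))) (fun z => exists e,
    F e = F (x (proj1_sig q)) /\ z = lax_map D (act e (proj1_sig q))).

Lemma lax_act_le_alpha e d : F e = F (x d) -> lax_map D (act e d) <= alpha e.
Proof.
  intros H; rewrite <- (act_over Hact H) at 2; apply (lax_le x).
Qed.

Lemma lax_act_le_beta b e d : F e = b -> F e = F (x d) ->
  lax_map D (act e d) <= beta b.
Proof.
  intros Hb H; transitivity (alpha e);
    [now apply lax_act_le_alpha | now apply alpha_le].
Qed.

Lemma orbit_join_ub (q : orbits Hact HF s) e :
  F e = F (x (proj1_sig q)) -> lax_map D (act e (proj1_sig q)) <= orbit_join q.
Proof.
  intros H; apply join_in_ub; [now apply lax_act_le_beta | now exists e].
Qed.

Lemma orbit_join_le (q : orbits Hact HF s) :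
  orbit_join q <= beta (orbits_map Hact HF s q).
Proof. apply join_in_le. Qed.

(** By condition (2), a value [z] along [q] is the join of its meets with [alpha a0] over the lifts
    [a0 <= a1]. Each such meet is below the value of [q] transported to [a0], by laxness of
    transport, and hence below that of [r] transported to [a1]. *)
Lemma orbit_join_mono (q r : orbits Hact HF s) :
  q <= r -> orbit_join q <= orbit_join r.
Proof.
  intros Hqr; pose proof (mono_le (orbits_map Hact HF s) Hqr) as Hb.
  pose proof (mono_le beta Hb) as Hbeta.
  apply join_in_le_above with (y := beta (orbits_map Hact HF s r));
    [exact Hbeta | apply orbit_join_le |].
  intros z Hz (e & He & ->).
  etransitivity; [apply (HJ Hb Hz) |].
  apply join_in_le_above with (y := beta (orbits_map Hact HF s r));
    [exact Hbeta | apply orbit_join_le |].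
  intros z' _ (a0 & a1 & L & H0 & H1 & ->); simpl in H0, H1.
  transitivity (lax_map D (act a0 (proj1_sig q))).
  - rewrite <- (act_act Hact H0 He); etransitivity;
      [| apply Hlax; rewrite (act_over Hact); congruence].
    rewrite H0; apply meet_in_swap_le; [exact Hz | now apply alpha_le].
  - transitivity (lax_map D (act a1 (proj1_sig r))).
    + apply mono_le; now apply orbits_le_act.
    + now apply orbit_join_ub.
Qed.

Definition lax_orbits : lax_obj X :=
  @LaxObj X (orbits Hact HF s) (Monotone orbit_join_mono).

Definition lax_orbits_map : lax_hom lax_orbits B :=
  @LaxHom X lax_orbits B (orbits_map Hact HF s) orbit_join_le.

(** Condition (3) for the values along the orbit; they form a compatible family because transport is
    lax. *)
Lemma lax_orbit_fold_le (t : Lax_pb_obj HX f lax_orbits_map) :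
  lax_map _ t <= lax_map D (orbit_fold Hact HF s t).
Proof.
  destruct t as [[e q] H]; simpl in *; unfold lax_pb_map; simpl.
  set (b := F (x (proj1_sig q))); change (F e = b) in H.
  rewrite (H : lax_fun f e = b).
  refine (HS (b := b) (sigma := fun a => lax_map D (act a (proj1_sig q)))
    _ _ H).
  - intros a; apply lax_act_le_alpha.
  - intros a a' Ha Ha'; rewrite <- (act_act Hact (e' := a) Ha' Ha).
    rewrite <- Ha'; apply Hlax; rewrite (act_over Hact Ha); congruence.
Qed.

Lemma lax_orbit_unfold_le d :
  lax_map D d <=
  lax_map (Lax_pb_obj HX f lax_orbits_map) (orbit_unfold Hact HF Hs d).
Proof.
  simpl; unfold lax_pb_map; simpl.
  assert (Hd : lax_map D d <= lax_map A (x d)) by apply (lax_le x).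
  apply meet_in_greatest.
  - transitivity (lax_map A (x d)); [exact Hd | apply (lax_le f)].
  - exact Hd.
  (* [d] is recovered by transporting its representative back to [x d], so its value occurs in the
     join. *)
  - pose proof (orbit_join_ub (q := orbit_of Hact HF Hs d) (e := x d)
      (orbits_map_orbit_of Hact HF Hs d)) as H.
    simpl in H.
    now rewrite (act_act Hact), (act_id Hact) in H
      by (try easy; now rewrite Hs).
Qed.

End Quotient.

Lemma Lax_effective_descent_of :
  effective_descent (LaxComma_pullbacks HX) f.
Proof.
  pose proof (lifts_triples_pairs HF) as Hp2.
  destruct (lifts_pairs_section Hp2) as [s Hs].
  apply is_equivalence_iff; split; [| split].
  - intros y z g h Egh; apply slice_hom_eq, lax_hom_eq, monotone_eq; intros d.
    pose proof (lax_hom_eqE (f_equal (@Lax_alg_map y z) Egh)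
      (@pb_pt _ _ F _ (slice_map y) _ d (Hs _))) as Ed.
    exact (f_equal (fun v => snd (proj1_sig v)) Ed).
  - intros y z h.
    destruct (pb_map_descends Hp2 (Lax_alg_map_fst h)
      (@Lax_alg_map_snd y z h)) as (k & Hk1 & Hk2).
    (* The descended monotone map must also be lax. This is tested over the fibre, where it follows
       from laxness of [h] at the pullback points. *)
    unshelve epose (k' := @LaxHom X (slice_dom y) (slice_dom z) k _).
    { intros d.
      apply (fibre_joins_le (b := slice_map y d)).
      - apply (lax_le (slice_map y)).
      - rewrite <- Hk1; apply (lax_le (slice_map z)).
      - intros a Ha; set (t := @pb_pt _ _ F _ (slice_map y) a d Ha).
        pose proof (lax_le (Lax_alg_map h) t) as Ht.
        transitivity (lax_map (Lax_pb_obj HX f (slice_map y)) t).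
        + simpl; unfold lax_pb_map; simpl.
          rewrite (Ha : lax_fun f a = _); apply meet_in_swap_le;
            [apply (lax_le (slice_map y)) | now apply alpha_le].
        + etransitivity; [exact Ht |].
          rewrite <- (Hk2 t : _ = k d); apply lax_pb_map_le2. }
    unshelve eexists (@SliceHom (LaxComma X) B y z k' _).
    + now apply lax_hom_eq, monotone_eq.
    + apply Lax_alg_map_eq; intros t.
      apply Ord_pb_eq; symmetry; [exact (Lax_alg_map_fst h t) | exact (Hk2 t)].
  - intros a; pose proof (Lax_alg_act_is_action a) as Hact.
    pose proof (@Lax_alg_act_le a) as Hlax.
    set (c := @SliceObj (LaxComma X) B (lax_orbits Hact Hlax s)
      (lax_orbits_map Hact Hlax s)).
    unshelve refine (ex_intro _ c (ex_intro _ (@AlgebraHom _ _ (K c) a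
      (@SliceHom (LaxComma X) A (alg_obj (K c)) (alg_obj a)
        (LaxHom (lax_orbit_fold_le (Hlax := Hlax) (s := s))) _) _) _)).
    + apply lax_hom_eq, monotone_eq; intros t; exact (orbit_fold_over t).
    + apply slice_hom_eq, lax_hom_eq, monotone_eq; intros t.
      refine (eq_trans _ (eq_sym (total_act_pb (Lax_alg_act a) _))).
      destruct t as [[e [[e' q] H']] H]; symmetry; apply (act_act Hact).
      * exact (eq_trans H H').
      * exact H'.
    + unshelve refine (ex_intro _ (@AlgebraHom _ _ a (K c)
        (@SliceHom (LaxComma X) A (alg_obj a) (alg_obj (K c))
          (LaxHom (lax_orbit_unfold_le Hact Hlax Hs)) _) _) _).
      * now apply lax_hom_eq, monotone_eq.
      * apply slice_hom_eq, lax_hom_eq, monotone_eq; intros t.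
        apply Ord_pb_eq; [exact (lax_hom_eqE (slice_tri (alg_act a)) t) |].
        refine (eq_trans (f_equal (orbit_of Hact HF Hs)
          (total_act_pb (Lax_alg_act a) t)) _).
        apply orbit_of_act; exact (proj2_sig t).
      * split; apply algebra_hom_eq, slice_hom_eq, lax_hom_eq, monotone_eq;
          intros t.
        -- exact (orbit_foldK Hs t).
        -- exact (orbit_unfoldK Hact HF Hs t).
Qed.

End Sufficiency.

(** * Algebras of the lax descent monad from pointwise laws *)

Section Algebras.

Variables (D : slice A).
Variables (xi : lax_hom (Lax_pb_obj HX f (slice_map (slice_push f D)))
                        (slice_dom D)).
Hypothesis (Hover : forall t, slice_map D (xi t) = fst (proj1_sig t)).
Hypothesis (Hid : forall t,
  fst (proj1_sig t) = slice_map D (snd (proj1_sig t)) ->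
  xi t = snd (proj1_sig t)).
Hypothesis (Hact : forall t u v, snd (proj1_sig t) = xi u ->
  fst (proj1_sig v) = fst (proj1_sig t) ->
  snd (proj1_sig v) = snd (proj1_sig u) -> xi t = xi v).

Program Definition Lax_algebra_act : hom (T D) D :=
  @SliceHom (LaxComma X) A (T D) D xi _.
Next Obligation. apply lax_hom_eq, monotone_eq; exact Hover. Qed.

Lemma Lax_algebra_act_unit : Lax_algebra_act \o munit T D = idm D.
Proof.
  apply Lax_slice_ext; intros t.
  change (xi (slice_fun (munit T D) t) = t).
  now apply Hid.
Qed.

(** [Hact] speaks of three separate points linked by equations, so that it applies here without an
    explicit description of the iterated pullback. *)
Lemma Lax_algebra_act_mult :
  Lax_algebra_act \o fmap T Lax_algebra_act = Lax_algebra_act \o mmult T D.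
Proof.
  apply Lax_slice_ext; intros t.
  change (xi (slice_fun (fmap T Lax_algebra_act) t) =
          xi (slice_fun (mmult T D) t)).
  apply (Hact (u := snd (proj1_sig t))); simpl; reflexivity.
Qed.

Definition Lax_algebra : algebra T :=
  Algebra Lax_algebra_act_unit Lax_algebra_act_mult.

End Algebras.

(** * Effective descent implies the three conditions *)

Section Necessity.

Hypothesis (Hed : effective_descent (LaxComma_pullbacks HX) f).

(** The argument for ordered sets applies once both test objects take their values from [beta]: all
    the laxness conditions then hold by reflexivity. *)
Lemma Lax_effective_descent_lifts_pairs : lifts_pairs F.
Proof.
  destruct (proj1 (is_equivalence_iff _) Hed) as (Hfa & Hfu & _).
  intros b0 b1 Hb; apply NNPP; intros Hno.
  set (D := @LaxObj X discrete_bool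
    (mono_comp beta (discrete_bool_map b0 b1))).
  set (C := @LaxObj X chain_bool (mono_comp beta (chain_bool_map Hb))).
  set (y := @SliceObj (LaxComma X) B D (@LaxHom X D B (discrete_bool_map b0 b1)
    (fun _ => reflexivity _)) : slice B).
  set (z := @SliceObj (LaxComma X) B C (@LaxHom X C B (chain_bool_map Hb)
    (fun _ => reflexivity _)) : slice B).
  unshelve epose (i := @SliceHom (LaxComma X) B y z (@LaxHom X D C bool_id
    (fun _ => reflexivity _)) _ : hom y z).
  { now apply lax_hom_eq, monotone_eq. }
  destruct (@Lax_algebra_hom z y
    (@LaxHom X (Lax_pb_obj HX f (slice_map z)) (Lax_pb_obj HX f (slice_map y))
      (pb_chain_discrete Hb Hno) (fun _ => reflexivity _))) as [h Hh];
    [easy | easy |].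
  destruct (Hfu z y h) as [k Hk].
  assert (Eik : i \o k = idm z).
  { apply Hfa; rewrite fmap_comp, fmap_id, Hk.
    apply Lax_alg_map_eq; intros t.
    pose proof (lax_hom_eqE Hh t) as Et.
    apply Ord_pb_eq.
    - exact (f_equal (fun v => fst (proj1_sig v)) Et).
    - exact (f_equal (fun v => snd (proj1_sig v)) Et). }
  assert (Ek : forall j, slice_fun k j = j)
    by exact (lax_hom_eqE (f_equal (@slice_fun _ _ _ _) Eik)).
  pose proof (mono_le (slice_fun k) (x := false) (y := true)
    (or_introl eq_refl)) as Hft.
  rewrite !Ek in Hft; discriminate Hft.
Qed.

(** The family with values [delta] is an algebra, hence isomorphic to a pullback. Laxness of the
    isomorphism in both directions compares [delta] with the meet of [alpha] and the value of [Q],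
    which gives the last two clauses. *)
Lemma Lax_effective_descent_family (I : Type) (y : I -> lax_dom B)
    (R : I -> I -> Prop) (HR : lifted_preorder F y R)
    (delta : monotone (family HR) X) :
  (forall t, delta t <= alpha (fst (proj1_sig t))) ->
  (forall t u, snd (proj1_sig t) = snd (proj1_sig u) ->
    meet_in HX (beta (F (fst (proj1_sig t)))) (alpha (fst (proj1_sig t)))
      (delta u) <= delta t) ->
  exists (Q : lax_obj X) (g : I -> Q), family_reflected F y R g /\
    (forall i, lax_map Q (g i) <= beta (y i)) /\
    (forall t, delta t <= lax_map Q (g (snd (proj1_sig t)))) /\
    forall t, meet_in HX (beta (y (snd (proj1_sig t))))
      (alpha (fst (proj1_sig t))) (lax_map Q (g (snd (proj1_sig t))))
      <= delta t.
Proof.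
  intros Hover Hlax.
  pose proof (lifts_pairs_surj Lax_effective_descent_lifts_pairs) as Hp.
  destruct (proj1 (is_equivalence_iff _) Hed) as (_ & _ & Hes).
  set (L := @LaxObj X (family HR) delta).
  set (D := @SliceObj (LaxComma X) A L (@LaxHom X L A (family_fst HR) Hover)
    : slice A).
  set (xi := @LaxHom X (Lax_pb_obj HX f (slice_map (slice_push f D))) L
    (family_act HR)
    (fun t => Hlax (family_act HR t) (snd (proj1_sig t)) eq_refl)).
  unshelve epose (a := @Lax_algebra D xi _ _ _).
  { easy. }
  { intros t Ht; apply family_eq; [exact Ht | reflexivity]. }
  { intros t u v Htu Hvt Hvu; apply family_eq; [exact (eq_sym Hvt) |].
    exact (eq_trans (f_equal (fun z : family HR => snd (proj1_sig z)) Htu)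
      (f_equal (fun z : family HR => snd (proj1_sig z)) (eq_sym Hvu))). }
  destruct (Hes a) as (c & h & h' & _ & Hh).
  assert (HhK : forall t, slice_fun (alg_fun h) (slice_fun (alg_fun h') t) = t)
    by exact (lax_hom_eqE (f_equal (fun k : algebra_hom a a =>
      slice_fun (alg_fun k)) Hh)).
  assert (Hfst : forall t, fst (proj1_sig (slice_fun (alg_fun h') t)) =
                           fst (proj1_sig t))
    by exact (lax_hom_eqE (slice_tri (alg_fun h'))).
  destruct (@family_iso_reflected _ _ F I y R HR (lax_dom (slice_dom c))
    (slice_map c) (slice_fun (alg_fun h)) (slice_fun (alg_fun h')))
    as (g & Hg & Hsnd).
  - exact Hp.
  - exact HhK.
  - exact Hfst.
  - intros t v Htv.
    assert (H : F (fst (proj1_sig t)) = F (fst (proj1_sig v)))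
      by now rewrite (proj2_sig t), (proj2_sig v), Htv.
    pose proof (lax_hom_eqE (f_equal (@slice_fun _ _ _ _) (alg_fun_act h'))
      (act_pt (x := family_fst HR) H)) as Ev.
    refine (eq_trans _ (f_equal (fun v => snd (proj1_sig v)) Ev)).
    apply (f_equal (fun v : family HR =>
      snd (proj1_sig (slice_fun (alg_fun h') v)))).
    now apply family_eq.
  - exists (slice_dom c), g; split; [exact Hg | split; [| split]].
    + intros i; destruct (Hp (y i)) as [e He].
      set (t := family_pt HR He).
      rewrite <- (Hsnd t : _ = g i).
      replace (y i) with
        (slice_map c (snd (proj1_sig (slice_fun (alg_fun h') t)))).
      * apply (lax_le (slice_map c)).
      * refine (eq_trans (eq_sym (proj2_sig (slice_fun (alg_fun h') t))) _).
        exact (eq_trans (f_equal F (Hfst t)) He).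
    + intros t; rewrite <- Hsnd.
      etransitivity; [exact (lax_le (slice_fun (alg_fun h')) t) |].
      apply lax_pb_map_le2.
    + intros t; rewrite <- Hsnd, <- (proj2_sig t).
      (* Laxness of [h] at [h' t], whose image under [h] is [t]. *)
      pose proof (lax_le (slice_fun (alg_fun h)) (slice_fun (alg_fun h') t))
        as Ht.
      rewrite HhK in Ht.
      change (meet_in HX (beta (F (fst (proj1_sig (slice_fun (alg_fun h') t)))))
        (alpha (fst (proj1_sig (slice_fun (alg_fun h') t))))
        (lax_map (slice_dom c) (snd (proj1_sig (slice_fun (alg_fun h') t))))
        <= delta t) in Ht.
      now rewrite Hfst in Ht.
Qed.

(** With [alpha] itself as the values, the conditions on [delta] hold for every relation [R], so the
    order-theoretic argument applies. *)
Lemma Lax_effective_descent_lifts_triples : lifts_triples F.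
Proof.
  apply lifts_triples_of_families.
  - apply Lax_effective_descent_lifts_pairs.
  - intros y R HR.
    destruct (@Lax_effective_descent_family three y R HR
      (mono_comp alpha (family_fst HR))) as (Q & g & Hg & _).
    + intros t; reflexivity.
    + intros t u _; apply meet_in_lel; now apply alpha_le.
    + now exists Q, g.
Qed.

(** Two one-point objects over [b] carry the values [w] and [v]. The hypothesis makes the identity
    lax between their pullbacks, and fullness yields a morphism between the points, whose laxness is
    [w <= v]. *)
Lemma Lax_effective_descent_fibre_le b w v : w <= beta b -> v <= beta b ->
  (forall a, F a = b -> meet_in HX (beta b) (alpha a) w <= v) -> w <= v.
Proof.
  intros Hw Hv H.
  destruct (proj1 (is_equivalence_iff _) Hed) as (_ & Hfu & _).
  set (pt := fun u => @LaxObj X unit_ord (const_mono unit_ord u)).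
  set (y := fun u (Hu : u <= beta b) => @SliceObj (LaxComma X) B (pt u)
    (@LaxHom X (pt u) B (const_mono unit_ord b) (fun _ => Hu)) : slice B).
  unshelve epose (h := @LaxHom X (Lax_pb_obj HX f (slice_map (y w Hw)))
    (Lax_pb_obj HX f (slice_map (y v Hv))) (mono_id _) _).
  { intros [[a j] Ha]; simpl in *; unfold lax_pb_map; simpl.
    rewrite (Ha : lax_fun f a = b); apply meet_in_greatest.
    - apply meet_in_le.
    - apply meet_in_lel; now apply alpha_le.
    - now apply H. }
  destruct (@Lax_algebra_hom (y w Hw) (y v Hv) h) as [k _]; [easy | easy |].
  destruct (Hfu _ _ k) as [k' _].
  exact (lax_le (slice_fun k') tt).
Qed.

(** Over the chain [b0 <= b1], the index [false] receives [w] and [true] receives the join [v], both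
    cut down by [alpha]. Descent inserts the values of [g false] and [g true] between [w] and
    [v]. *)
Lemma Lax_effective_descent_lifted_joins : lifted_joins.
Proof.
  intros b0 b1 Hb w Hw.
  set (v := join_in HX (beta b0) (fun x => exists a0 a1 : lax_dom A,
    a0 <= a1 /\ F a0 = b0 /\ F a1 = b1 /\
    x = meet_in HX (beta b0) w (alpha a0))).
  assert (Hv0 : v <= beta b0) by apply join_in_le.
  assert (Hbeta : beta b0 <= beta b1) by now apply mono_le.
  assert (Hv1 : v <= beta b1) by now transitivity (beta b0).
  set (y := bool_pt b0 b1); set (r := fun i : bool => if i then v else w).
  assert (Hr : forall i, r i <= beta (y i)) by now intros [].
  assert (HR : lifted_preorder F y (@le chain_bool)).
  { split; [reflexivity |].
    intros i j k e0 e1 e2 _ _ _ _ Hij Hjk; now transitivity j. }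
  unshelve epose (delta := @Monotone (family HR) X (fun t =>
    meet_in HX (beta (y (snd (proj1_sig t)))) (alpha (fst (proj1_sig t)))
      (r (snd (proj1_sig t)))) _).
  { intros [[e i] He] [[e' j] He'] [L Hij]; simpl in *.
    assert (Ha : alpha e <= beta (y i)) by now apply alpha_le.
    assert (Hbij : beta (y i) <= beta (y j)).
    { rewrite <- He, <- He'; now do 2 apply mono_le. }
    apply meet_in_greatest.
    - transitivity (beta (y i)); [apply meet_in_le | exact Hbij].
    - transitivity (alpha e); [now apply meet_in_lel | now apply mono_le].
    - destruct i, j; simpl in *; try now apply meet_in_ler.
      + now destruct Hij.
      (* From [false] to [true]: [e] and [e'] lift [b0 <= b1], so the meet is one of the elements
         joined in [v]. *)
      + etransitivity; [now apply meet_in_swap_le |].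
        apply join_in_ub; [apply meet_in_le | now exists e, e']. }
  destruct (@Lax_effective_descent_family bool y _ HR delta)
    as (Q & g & Hg & Hgb & Hge & Hgm).
  - intros [[e i] He]; simpl in *; apply meet_in_lel; now apply alpha_le.
  - intros [[e i] He] [[e' j] He']; simpl in *; intros <-.
    assert (Ha : alpha e <= beta (F e)) by now apply alpha_le.
    assert (Hd : meet_in HX (beta (y i)) (alpha e') (r i) <= beta (F e))
      by (rewrite He; apply meet_in_le).
    rewrite <- He; apply meet_in_greatest.
    + apply meet_in_le.
    + now apply meet_in_lel.
    + transitivity (meet_in HX (beta (y i)) (alpha e') (r i)).
      * rewrite He in *; now apply meet_in_ler.
      * now apply meet_in_ler.
  - transitivity (lax_map Q (g false)).
    + apply (Lax_effective_descent_fibre_le (b := b0));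
        [exact Hw | exact (Hgb false) |].
      intros a Ha; exact (Hge (family_pt (i := false) HR Ha)).
    + transitivity (lax_map Q (g true)).
      (* A lift is required, since [Q] is only known to reflect the order of indices over comparable
         points of [A]. *)
      * destruct (Lax_effective_descent_lifts_pairs Hb)
          as (e0 & e1 & L & H0 & H1).
        apply mono_le; apply (Hg false true e0 e1 H0 H1 L); now left.
      * apply (Lax_effective_descent_fibre_le (b := b1));
          [exact (Hgb true) | exact Hv1 |].
        intros a Ha.
        etransitivity; [exact (Hgm (family_pt (i := true) HR Ha)) |].
        simpl; now apply meet_in_ler.
Qed.

(** With a single index the family is the fibre of [b] with values [sigma]. The value of the
    descended point bounds the join, and its meet with [alpha a'] is at most [sigma a']. *)
Lemma Lax_effective_descent_fibre_joins : fibre_joins.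
Proof.
  intros b sigma Hsigma Hcomp a' Ha'.
  assert (HR : lifted_preorder F (fun _ : unit => b) (fun _ _ => True))
    by now split.
  unshelve epose (delta := @Monotone (family HR) X
    (fun t => sigma (fst (proj1_sig t))) _).
  { intros [[e i] He] [[e' j] He'] [L _]; simpl in *.
    (* Compatibility makes [sigma] monotone on the fibre: as [sigma e <= alpha e <= alpha e'],
       meeting with [alpha e'] loses nothing. *)
    transitivity (meet_in HX (beta b) (alpha e') (sigma e)).
    - assert (Hs : sigma e <= alpha e) by now apply Hsigma.
      apply meet_in_greatest.
      + transitivity (alpha e); [exact Hs | now apply alpha_le].
      + transitivity (alpha e); [exact Hs | now apply mono_le].
      + reflexivity.
    - now apply Hcomp. }
  destruct (@Lax_effective_descent_family unit _ _ HR delta)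
    as (Q & g & Hg & Hgb & Hge & Hgm).
  - intros [[e i] He]; now apply Hsigma.
  - intros [[e i] He] [[e' j] He'] _; simpl in *; rewrite He; now apply Hcomp.
  - etransitivity; [| exact (Hgm (family_pt (i := tt) HR Ha'))]; simpl.
    assert (Hj : join_in HX (beta b) (fun x => exists a, F a = b /\ x = sigma a)
                 <= lax_map Q (g tt)).
    { apply join_in_least; [apply Hgb |].
      intros z _ (a & Ha & ->); exact (Hge (family_pt (i := tt) HR Ha)). }
    apply meet_in_le_meet_in; try reflexivity; try exact Hj.
    + now apply alpha_le.
    + apply join_in_le.
Qed.

End Necessity.

End LaxDescent.

Lemma Lax_effective_descent_iff (X : ordset) (HX : locally_complete X)
    (A B : LaxComma X) (f : hom A B) :
  effective_descent (LaxComma_pullbacks HX) f <->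
  lifts_triples (lax_fun f) /\ lifted_joins HX f /\ fibre_joins HX f.
Proof.
  split.
  - intros Hed; split; [| split].
    + exact (Lax_effective_descent_lifts_triples Hed).
    + exact (Lax_effective_descent_lifted_joins Hed).
    + exact (Lax_effective_descent_fibre_joins Hed).
  - intros (HF & HJ & HS); exact (Lax_effective_descent_of HF HJ HS).
Qed.

Theorem theorem4p3 (X : ordset) (HX : locally_complete X)
    (A B : LaxComma X) (f : hom A B) :
  let alpha := lax_map A in
  let beta := lax_map B in
  let F : @hom Ord (lax_dom A) (lax_dom B) := lax_fun f in
  (effective_descent Ord_pullbacks F <->
    (forall b0 b1 b2 : lax_dom B, b0 <= b1 <= b2 ->
      exists a0 a1 a2 : lax_dom A,
        a0 <= a1 <= a2 /\ F a0 = b0 /\ F a1 = b1 /\ F a2 = b2)) /\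
  (effective_descent (LaxComma_pullbacks HX) f <->
    effective_descent Ord_pullbacks F /\
    (forall (b0 b1 : lax_dom B), b0 <= b1 ->
      forall w : X, w <= beta b0 ->
        w ~= join_in HX (beta b0) (fun x => exists a0 a1 : lax_dom A,
               a0 <= a1 /\ F a0 = b0 /\ F a1 = b1 /\
               x = meet_in HX (beta b0) w (alpha a0))) /\
    (forall sigma : lax_dom A -> X,
      (forall a, sigma a <= alpha a) ->
      (forall (b : lax_dom B) (a a' : lax_dom A), F a = b -> F a' = b ->
        meet_in HX (beta b) (sigma a') (alpha a) ~=
        meet_in HX (beta b) (alpha a') (sigma a)) ->
      forall (b : lax_dom B) (a' : lax_dom A), F a' = b ->
        meet_in HX (beta b) (alpha a')
          (join_in HX (beta b) (fun x => exists a, F a = b /\ x = sigma a))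
        ~= sigma a')).
Proof.
  intros alpha beta F; split; [apply Ord_effective_descent_iff |].
  assert (Hal : forall a b, F a = b -> alpha a <= beta b)
    by exact (alpha_le (f := f)).
  rewrite (Ord_effective_descent_iff F), Lax_effective_descent_iff.
  split; intros (HF & HJ & HS); split; [exact HF | | exact HF |]; split.
  - intros b0 b1 Hb w Hw; split; [now apply HJ |].
    apply join_in_least; [exact Hw |].
    intros z _ (a0 & a1 & _ & _ & _ & ->); now apply meet_in_lel.
  - intros sigma Hsigma Hcomp b a' Ha'; split.
    + apply HS; [now intros a _ | | exact Ha'].
      (* The symmetric hypothesis implies [compatible], as one of its two meets lies below
         [sigma a2]. *)
      intros a1 a2 Ha1 Ha2.
      etransitivity; [apply (proj2 (Hcomp b a1 a2 Ha1 Ha2)) |].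
      apply meet_in_lel.
      transitivity (alpha a2); [apply Hsigma | now apply Hal].
    + assert (Hs : sigma a' <= beta b)
        by (transitivity (alpha a'); [apply Hsigma | now apply Hal]).
      apply meet_in_greatest; [exact Hs | apply Hsigma |].
      apply join_in_ub; [exact Hs | now exists a'].
  - intros b0 b1 Hb w Hw; now apply HJ.
  - intros b sigma Hsigma Hcomp a' Ha'.
    (* The hypothesis speaks of all fibres: extend the family by [alpha]
       outside the fibre of [b]. *)
    set (tau := fun a => if excluded_middle_informative (F a = b)
                         then sigma a else alpha a).
    assert (Hin : forall a, F a = b -> tau a = sigma a).
    { intros a Ha; unfold tau; now destruct excluded_middle_informative. }
    assert (Hout : forall a, F a <> b -> tau a = alpha a).
    { intros a Ha; unfold tau; now destruct excluded_middle_informative. }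
    assert (Htau : forall a, tau a <= alpha a).
    { intros a; unfold tau; destruct excluded_middle_informative;
        [now apply Hsigma | reflexivity]. }
    assert (Hle : forall c a1 a2, F a1 = c -> F a2 = c ->
      meet_in HX (beta c) (alpha a2) (tau a1) <= tau a2).
    { intros c a1 a2 H1 H2; destruct (classic (c = b)) as [-> | Hc].
      - rewrite !Hin by assumption; now apply Hcomp.
      - rewrite (Hout a2) by congruence; apply meet_in_lel; now apply Hal. }
    assert (Hb : forall c a, F a = c -> tau a <= beta c).
    { intros c a Ha; transitivity (alpha a); [apply Htau | now apply Hal]. }
    rewrite <- (Hin a' Ha').
    etransitivity; [| apply (HS tau Htau) with (b := b); [| exact Ha']].
    + apply meet_in_le_meet_in; try reflexivity; try now apply Hal.
      * apply join_in_le.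
      * apply join_in_least; [apply join_in_le |].
        intros z Hz (a & Ha & ->); apply join_in_ub; [exact Hz |].
        exists a; split; [exact Ha | now rewrite Hin].
    (* Conversely, the one-sided [Hle], used for [a1] and [a2] in both orders, gives the symmetric
       form. *)
    + intros c a1 a2 H1 H2.
      pose proof (Hal _ _ H1) as A1; pose proof (Hal _ _ H2) as A2.
      pose proof (Hb c a1 H1) as T1; pose proof (Hb c a2 H2) as T2.
      split; apply meet_in_greatest; try apply meet_in_le.
      * transitivity (tau a2); [now apply meet_in_lel | apply Htau].
      * etransitivity; [now apply meet_in_swap_le | now apply Hle].
      * now apply Hle.
      * transitivity (tau a1); [now apply meet_in_ler | apply Htau].
Qed.
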